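(* Let $\|\cdot\|_s$ be the norm on $\mathbb{R}^2$ obtained as one half of the length function $\ell$ on the first homology $H_1(X,\mathbb{R})\cong\mathbb{R}^2$ of the modular torus $X$ (with the identification fixed in the context, for which $(1,0),(0,1),(-1,1)$ all correspond to the Markov number $1$). Let $p,q$ be non-negative real numbers and let $i>0$ be a real number. Then $$\|(q,p)\|_s<\|(q+i,p)\|_s$$ and $$\|(q,p)\|_s<\|(q,p+i)\|_s .$$ If in addition $p<q$, then $$\|(q,p)\|_s<\|(q+i,p-i)\|_s .$$
   Context: Modular torus: $X=\mathbb{H}/\Gamma$, where $\mathbb{H}$ is the hyperbolic upper half plane and $\Gamma$ is the commutator subgroup of $\mathrm{PSL}(2,\mathbb{Z})$ acting by Möbius transformations. $X$ is a complete hyperbolic once-punctured torus and $\pi_1(X)\cong\Gamma$ is free of rank $2$. Length: for a hyperbolic element $\gamma\in\Gamma$, the length $\ell_X(\gamma)$ of the closed geodesic in its free homotopy class satisfies $2\cosh(\ell_X(\gamma)/2)=|\mathrm{tr}\,\gamma|$. Identification $H_1(X,\mathbb{Z})\cong\mathbb{Z}^2$: choose free generators $\alpha,\beta$ of $\Gamma$, represented by simple loops meeting in a single point, such that $|\mathrm{tr}\,\alpha|=|\mathrm{tr}\,\beta|=|\mathrm{tr}\,\alpha^{-1}\beta|=3$, and identify the class of $\alpha$ with $(1,0)$ and the class of $\beta$ with $(0,1)$, so that the class of $\alpha^{-1}\beta$ is $(-1,1)$. (Then $|\mathrm{tr}\,\alpha\beta|=6$.) Length function $\ell$ on homology: for $h\in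 H_1(X,\mathbb{Z})$, $\ell(h)$ is the length of the shortest multicurve (finite collection of oriented closed curves) representing $h$, with $\ell(0)=0$. For a primitive class $h$ (not a proper multiple of another class), $\ell(h)$ is the length of the unique simple closed geodesic in the class $h$, and $\ell(nh)=n\ell(h)$ for $n\in\mathbb{N}$. The function $\ell$ extends by homogeneity to $H_1(X,\mathbb{Q})$, where it is convex, and then by continuity to a convex function, in fact a norm, on $H_1(X,\mathbb{R})\cong\mathbb{R}^2$. Set $\|v\|_s=\tfrac12\ell(v)$ for $v\in\mathbb{R}^2$. Relation with Markov numbers: for a primitive vector $(q,p)\in\mathbb{Z}^2$, the number $\tfrac23\cosh(\|(q,p)\|_s)$ is the Markov number attached to $p/q$; for instance it equals $1$ at $(1,0)$, $(0,1)$ and $(-1,1)$, $2$ at $(1,1)$, and $5$ at $(2,1)$. *)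

(* Defs.v *)
From HB Require Import structures.
From mathcomp Require Import all_boot all_order all_algebra.
From mathcomp Require Import all_classical all_reals all_analysis.

Set Implicit Arguments.
Unset Strict Implicit.
Unset Printing Implicit Defensive.

Import Order.TTheory GRing.Theory Num.Theory.
Import numFieldNormedType.Exports.

Local Open Scope classical_set_scope.
Local Open Scope ring_scope.

(* A subset of PSL(2,Z) = SL(2,Z)/{1,-1} is represented by its preimage in
   SL(2,Z), a set of matrices stable under M |-> -M; an element of PSL(2,Z) is
   represented by either of its two lifts. *)
Definition SL2Z : set 'M[int]_2 := [set g | \det g = 1].

(* The constructor derivedN is what makes this the commutator subgroup taken
   in PSL(2,Z): -1 is not a product of commutators of SL(2,Z). *)
Inductive derived (G : set 'M[int]_2) : set 'M[int]_2 :=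
| derived1 : derived G 1
| derived_comm x y : G x -> G y -> derived G (x * y * x^-1 * y^-1)
| derivedM x y : derived G x -> derived G y -> derived G (x * y)
| derivedN x : derived G x -> derived G (- x).

Definition Gamma : set 'M[int]_2 := derived SL2Z.

(* Words in two letters and their inverses: the first boolean selects the
   letter (false for a, true for b), the second one says whether it is
   inverted. *)
Definition word : Type := seq (bool * bool).

Definition eval_letter (a b : 'M[int]_2) (x : bool * bool) : 'M[int]_2 :=
  let g := if x.1 then b else a in if x.2 then g^-1 else g.

Definition eval_word (a b : 'M[int]_2) (w : word) : 'M[int]_2 :=
  \prod_(x <- w) eval_letter a b x.

Definition reduced (w : word) : bool :=
  sorted (fun x y : bool * bool => y != (x.1, ~~ x.2)) w.

Definition free_generators (a b : 'M[int]_2) : Prop :=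
  [/\ Gamma a, Gamma b,
      forall g, Gamma g ->
        exists w, g = eval_word a b w \/ g = - eval_word a b w
    & forall w, reduced w -> w != [::] ->
        eval_word a b w <> 1 /\ eval_word a b w <> -1].

(* H_1(X,Z) is the abelianization Gamma/[Gamma,Gamma], identified with Z^2 by
   sending the classes of a and b to (1,0) and (0,1): g has class (m,n) when
   g = a^m b^n modulo [Gamma,Gamma]. *)
Definition homology_class (a b g : 'M[int]_2) (h : int * int) : Prop :=
  derived Gamma (g * (a ^ h.1 * b ^ h.2)^-1).

Definition hyperbolic (g : 'M[int]_2) : Prop := 2 < `|\tr g|.

(* The l >= 0 with 2 cosh (l / 2) = |tr g|. *)
Definition geodesic_length (R : realType) (g : 'M[int]_2) : R :=
  xget 0 [set l : R | 0 <= l /\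
                      expR (l / 2) + expR (- (l / 2)) = `|(\tr g)%:~R|].

(* A multicurve is a list of hyperbolic elements of Gamma, each standing for
   the oriented closed geodesic in its free homotopy class. Closed curves that
   are null-homotopic or go round the cusp are null-homologous and can be made
   arbitrarily short, so they do not matter for the shortest length. *)
Inductive represents (a b : 'M[int]_2) : seq 'M[int]_2 -> int * int -> Prop :=
| represents_nil : represents a b [::] 0
| represents_cons g c h k :
    Gamma g -> hyperbolic g -> homology_class a b g h ->
    represents a b c k -> represents a b (g :: c) (h + k).

Definition ellZ (R : realType) (a b : 'M[int]_2) (h : int * int) : R :=
  inf [set \sum_(g <- c) geodesic_length R g
      | c in [set c | represents a b c h]].

(* Extension to Q^2 by homogeneity: clear denominators and divide. *)
Definition ellQ (R : realType) (a b : 'M[int]_2) (w : rat * rat) : R :=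
  ellZ R a b (numq w.1 * denq w.2, numq w.2 * denq w.1)
    / (denq w.1 * denq w.2)%:~R.

Definition ratv (R : realType) (w : rat * rat) : R * R :=
  (ratr w.1, ratr w.2).

(* Extension to R^2 by continuity: the limit of ellQ at v along the rational
   vectors w <> v. *)
Definition ell (R : realType) (a b : 'M[int]_2) (v : R * R) : R :=
  lim (ellQ R a b @ filter_from (dnbhs v) (fun U => @ratv R @^-1` U)).

Definition norm_s (R : realType) (a b : 'M[int]_2) (v : R * R) : R :=
  ell a b v / 2.

(* Main.v *)
Require Import Defs.
From HB Require Import structures.
From mathcomp Require Import all_boot all_order all_algebra.
From mathcomp Require Import all_classical all_reals all_analysis.
From mathcomp Require Import ring lra zify.
Import Order.TTheory GRing.Theory Num.Theory.
Import numFieldNormedType.Exports.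
Local Open Scope ring_scope.

Set Implicit Arguments.
Unset Strict Implicit.
Unset Printing Implicit Defensive.

(* Everything follows from two estimates for N = norm_s, with k = 1 + sqrt 2.
   Curves of trace 6 in the classes (1,1), (-1,2) and (2,-1) bound N from above
   by 2 ln k there. Conversely, a word in the generators with exponent sums
   (m,n) has spectral radius at least k^(m+n) e^|m-n|, where e = 25/24, whence
     N (x,y) >= ln k (x + y) + ln e |x - y|.
   This is a ping-pong argument: each reduced word moves a vector through a
   finite automaton of cones carrying linear forms that are multiplied by at
   least the weight of the letter applied. Since e > 1, along a line of direction
   (1,0), (0,1) or (1,-1) the value of N at the midpoint of symmetry is smaller
   than at any point beyond, and N increases by convexity. No description of the
   shortest multicurves is needed: the limit defining ell is the stable norm of
   the subadditive function ellZ, which is sublinear and inherits both bounds. *)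

(** * Words and homology classes *)

Section Matrix2.
Variable T : comNzRingType.
Implicit Types M N : 'M[T]_2.

Lemma mulmx2E M N i j : (M * N) i j = M i 0 * N 0 j + M i 1 * N 1 j.
Proof.
rewrite mxE !big_ord_recl big_ord0 addr0.
by congr (_ * _ + M i _ * N _ j); apply/val_inj.
Qed.

Lemma tr2E M : \tr M = M 0 0 + M 1 1.
Proof.
rewrite /mxtrace !big_ord_recl big_ord0 addr0.
by congr (_ + M _ _); apply/val_inj.
Qed.

Lemma matrix2P M N : M 0 0 = N 0 0 -> M 0 1 = N 0 1 -> M 1 0 = N 1 0 ->
  M 1 1 = N 1 1 -> M = N.
Proof.
move=> e00 e01 e10 e11; apply/matrixP.
have H (k : 'I_2) : k = 0 \/ k = 1.
  by case: k => -[|[|//]] lt_k; [left|right]; apply/val_inj.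
by move=> i j; case: (H i) => ->; case: (H j) => ->.
Qed.

Lemma det2E M : \det M = M 0 0 * M 1 1 - M 0 1 * M 1 0.
Proof.
rewrite (expand_det_row _ 0) !big_ord_recl big_ord0 addr0 /cofactor !det_mx11.
rewrite !mxE /= expr0 expr1 mul1r mulN1r mulrN.
by congr (M _ _ * M _ _ - M _ _ * M _ _); apply/val_inj.
Qed.

Definition mat2 (x y z t : T) : 'M[T]_2 :=
  \matrix_(i, j) if i == 0 then if j == 0 then x else y
                 else if j == 0 then z else t.

Lemma mat2E x y z t : (mat2 x y z t 0 0 = x) * (mat2 x y z t 0 1 = y) *
  (mat2 x y z t 1 0 = z) * (mat2 x y z t 1 1 = t).
Proof. by rewrite !mxE. Qed.

End Matrix2.

Lemma cayley2 (T : comNzRingType) (M : 'M[T]_2) :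
  M * M = \tr M *: M - (\det M)%:M.
Proof.
by apply: matrix2P; rewrite mulmx2E tr2E det2E !mxE /= ?mulr1n ?mulr0n; ring.
Qed.

(** Polarization of [cayley2]: the part of its instance for M + N that is bilinear in M and N. It
    reorders products, so that 1, M, N, MN span an algebra. *)
Lemma cayley2_polar (T : comNzRingType) (M N : 'M[T]_2) :
  N * M = - (M * N) + \tr N *: M + \tr M *: N
          + (\tr (M * N) - \tr M * \tr N)%:M.
Proof.
have MN := mulmx2E M N; have NM := mulmx2E N M.
move: (M * N) (N * M) MN NM => P Q hP hQ.
by apply: matrix2P; rewrite !tr2E !mxE !hP hQ /= ?mulr1n ?mulr0n; ring.
Qed.

Lemma det2N (T : comNzRingType) (M : 'M[T]_2) : \det (- M) = \det M.
Proof. by rewrite !det2E !mxE; ring. Qed.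

Lemma inv2E (T : comUnitRingType) (M : 'M[T]_2) :
  \det M = 1 -> M^-1 = (\tr M)%:M - M.
Proof.
move=> dM; have uM : M \is a GRing.unit by rewrite unitmxE dM unitr1.
apply: (mulrI uM); rewrite divrr // mulrBr cayley2 dM [M * _]mul_mx_scalar.
by rewrite opprB addrC subrK.
Qed.

Section Words.
Variables a b : 'M[int]_2.
Hypotheses (da : \det a = 1) (db : \det b = 1).

Let ua : a \is a GRing.unit. Proof. by rewrite unitmxE da unitr1. Qed.
Let ub : b \is a GRing.unit. Proof. by rewrite unitmxE db unitr1. Qed.

Definition letter_class (x : bool * bool) : int * int :=
  let e : int := if x.2 then -1 else 1 in if x.1 then (0, e) else (e, 0).

(** Exponent sums: the image of the word in the abelianized free group. *)
Definition word_class (w : word) : int * int := \sum_(x <- w) letter_class x.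

Definition letter_inv (x : bool * bool) : bool * bool := (x.1, ~~ x.2).

Definition word_inv (w : word) : word := rev (map letter_inv w).

Lemma eval_nil : eval_word a b [::] = 1.
Proof. by rewrite /eval_word big_nil. Qed.

Lemma eval_cons x w : eval_word a b (x :: w) = eval_letter a b x * eval_word a b w.
Proof. by rewrite /eval_word big_cons. Qed.

Lemma eval_cat v w : eval_word a b (v ++ w) = eval_word a b v * eval_word a b w.
Proof. by rewrite /eval_word big_cat. Qed.

Lemma word_class_cat v w : word_class (v ++ w) = word_class v + word_class w.
Proof. by rewrite /word_class big_cat. Qed.

Lemma eval_letter_unit x : eval_letter a b x \is a GRing.unit.
Proof. by case: x => [] [] []; rewrite /eval_letter /= ?unitrV. Qed.

Lemma eval_letter_inv x : eval_letter a b (letter_inv x) = (eval_letter a b x)^-1.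
Proof. by case: x => [] [] []; rewrite /eval_letter /= ?invrK. Qed.

Lemma eval_unit w : eval_word a b w \is a GRing.unit.
Proof.
elim: w => [|x w IH]; first by rewrite eval_nil unitr1.
by rewrite eval_cons unitrMl ?eval_letter_unit.
Qed.

Lemma eval_inv w : eval_word a b (word_inv w) = (eval_word a b w)^-1.
Proof.
elim: w => [|x w IH]; first by rewrite eval_nil invr1.
rewrite /word_inv /= rev_cons -cats1 eval_cat IH !eval_cons eval_nil mulr1.
by rewrite eval_letter_inv invrM ?eval_unit ?eval_letter_unit.
Qed.

Lemma word_class_inv w : word_class (word_inv w) = - word_class w.
Proof.
elim: w => [|x w IH]; first by rewrite /word_class /word_inv /= !big_nil oppr0.
rewrite /word_inv /= rev_cons -cats1 word_class_cat IH /word_class !big_cons.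
rewrite big_nil addr0 opprD addrC; congr (_ + _).
by case: x => [] [] [].
Qed.

Lemma word_pow (x : bool) (m : int) : exists w,
  eval_word a b w = (if x then b else a) ^ m /\
  word_class w = if x then (0, m) else (m, 0).
Proof.
have nat_pow (n : nat) : exists w, eval_word a b w = (if x then b else a) ^+ n /\
    word_class w = if x then (0, n%:Z) else (n%:Z, 0).
  elim: n => [|n [w [ew cw]]].
    by exists [::]; rewrite eval_nil expr0 /word_class big_nil; case: x.
  exists ((x, false) :: w); rewrite eval_cons ew exprS; split; first by case: x {ew cw}.
  rewrite /word_class big_cons -/(word_class w) cw /letter_class /=.
  by case: x {ew cw}; congr (_, _); lia.
case: m => n; first exact: nat_pow.
case: (nat_pow n.+1) => w [ew cw]; exists (word_inv w).
rewrite eval_inv ew word_class_inv cw; split; first by [].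
by case: x {ew cw nat_pow}; rewrite NegzE.
Qed.

End Words.

(** Equality of the classes in PSL(2,Z). *)
Definition eq_upto_sign (g h : 'M[int]_2) : Prop := g = h \/ g = - h.

Lemma upto_signM g h g' h' : eq_upto_sign g h -> eq_upto_sign g' h' ->
  eq_upto_sign (g * g') (h * h').
Proof.
by case=> -> [] ->; rewrite ?mulrNN ?mulrN ?mulNr; [left|right|right|left].
Qed.

Lemma upto_sign_trans g h k :
  eq_upto_sign g h -> eq_upto_sign h k -> eq_upto_sign g k.
Proof. by case=> -> [] ->; rewrite ?opprK; [left|right|right|left]. Qed.

Lemma upto_signN g h : eq_upto_sign g h -> eq_upto_sign (- g) h.
Proof. by case=> ->; rewrite ?opprK; [right|left]. Qed.

Lemma upto_signV g h : eq_upto_sign g h -> eq_upto_sign g^-1 h^-1.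
Proof. by case=> ->; rewrite ?invrN; [left|right]. Qed.

Lemma det_inv (g : 'M[int]_2) : \det g = 1 -> \det g^-1 = 1.
Proof. by move=> dg; rewrite [g^-1]/(invmx g) det_inv dg invr1. Qed.

Lemma derived_det (G : set 'M[int]_2) : (forall g, G g -> \det g = 1) ->
  forall g, derived G g -> \det g = 1.
Proof.
move=> dG g; elim=> [|x y /dG dx /dG dy|x y _ dx _ dy|x _ dx].
- exact: det1.
- by rewrite !det_mulmx !det_inv ?dx ?dy ?mulr1.
- by rewrite det_mulmx dx dy mulr1.
- by rewrite det2N.
Qed.

Lemma derived_inv (G : set 'M[int]_2) : (forall g, G g -> \det g = 1) ->
  forall g, derived G g -> derived G g^-1.
Proof.
move=> dG.
have unit_of g : \det g = 1 -> g \is a GRing.unit.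
  by move=> dg; rewrite unitmxE dg unitr1.
have uG g : G g -> g \is a GRing.unit by move/dG/unit_of.
have uD g : derived G g -> g \is a GRing.unit.
  by move=> Dg; apply/unit_of/(derived_det dG).
move=> g; elim=> [|x y Gx Gy|x y Dx Dx' Dy Dy'|x _ Dx].
- by rewrite invr1; apply: derived1.
- rewrite !invrM ?unitrMl ?unitrV ?uG // !invrK !mulrA.
  exact: derived_comm.
- by rewrite invrM ?uD //; apply: derivedM.
- by rewrite invrN; apply: derivedN.
Qed.

Lemma Gamma_det g : Gamma g -> \det g = 1.
Proof. exact: derived_det. Qed.

Lemma Gamma_inv g : Gamma g -> Gamma g^-1.
Proof. exact: derived_inv. Qed.

Section Classes.
Variables a b : 'M[int]_2.
Hypothesis hfree : free_generators a b.

Let da : \det a = 1. Proof. by case: hfree => /Gamma_det. Qed.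
Let db : \det b = 1. Proof. by case: hfree => _ /Gamma_det. Qed.

(** Commutators of elements of [Gamma] become, up to sign, commutators of words, whose exponent sums
    cancel. *)
Lemma derived_Gamma_word g : derived Gamma g ->
  exists2 w, eq_upto_sign g (eval_word a b w) & word_class w = 0.
Proof.
case: hfree => _ _ gen _.
elim=> [|x y /gen[v hv] /gen[w hw]|x y _ [v hv cv] _ [w hw cw]|x _ [w hw cw]].
- by exists [::]; [left; rewrite eval_nil | rewrite /word_class big_nil].
- exists (v ++ w ++ word_inv v ++ word_inv w).
    rewrite !eval_cat !eval_inv // !mulrA.
    by do 3?apply: upto_signM => //; apply: upto_signV.
  by rewrite !word_class_cat !word_class_inv; ring.
- exists (v ++ w); first by rewrite eval_cat; apply: upto_signM.
  by rewrite word_class_cat cv cw addr0.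
- by exists w => //; apply: upto_signN.
Qed.

Lemma homology_class_word g h : homology_class a b g h ->
  exists2 w, eq_upto_sign g (eval_word a b w) & word_class w = h.
Proof.
move=> /derived_Gamma_word[u hu cu].
have [v [ev cv]] := word_pow da db false h.1.
have [w [ew cw]] := word_pow da db true h.2.
have uvw : a ^ h.1 * b ^ h.2 \is a GRing.unit.
  by rewrite -ev -ew -eval_cat eval_unit.
exists (u ++ v ++ w); last first.
  rewrite !word_class_cat cu cv cw; case: h {hu ev cv ew cw uvw} => m n.
  by congr (_, _); rewrite /=; ring.
rewrite -(divrK uvw g) !eval_cat ev ew.
by apply: upto_signM => //; left.
Qed.

End Classes.

(** * Traces of words *)

Definition span4 (a b : 'M[int]_2) (c : int * int * (int * int)) : 'M[int]_2 :=
  (c.1.1)%:M + c.1.2 *: a + c.2.1 *: b + c.2.2 *: (a * b).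

(* Left multiplication by a letter on coordinates in the family 1, a, b, ab,
   where x = tr a, y = tr b and z = tr (ab). *)
Definition mul_letter (x y z : int) (l : bool * bool)
    (c : int * int * (int * int)) : int * int * (int * int) :=
  let: (c0, c1, (c2, c3)) := c in
  match l with
  | (false, false) => (- c1, c0 + x * c1, (- c3, c2 + x * c3))
  | (false, true) => (x * c0 + c1, - c0, (x * c2 + c3, - c2))
  | (true, false) => (c1 * (z - x * y) - c2 - x * c3, c1 * y + c3,
                      (c0 + x * c1 + y * c2 + z * c3, - c1))
  | (true, true) => (y * c0 - (c1 * (z - x * y) - c2 - x * c3),
                     y * c1 - (c1 * y + c3),
                     (y * c2 - (c0 + x * c1 + y * c2 + z * c3), y * c3 + c1))
  end.

Lemma eval_letter_span (a b : 'M[int]_2) (l : bool * bool) c :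
  \det a = 1 -> \det b = 1 ->
  eval_letter a b l * span4 a b c =
  span4 a b (mul_letter (\tr a) (\tr b) (\tr (a * b)) l c).
Proof.
move=> da db; case: c => -[c0 c1] [c2 c3].
have aa : a * a = \tr a *: a - 1%:M by rewrite cayley2 da.
have bb : b * b = \tr b *: b - 1%:M by rewrite cayley2 db.
have ba := cayley2_polar a b.
have aab : a * (a * b) = \tr a *: (a * b) - b.
  by rewrite mulrA aa mulrBl -scalerAl mul1r.
have bab : b * (a * b) = a - (\tr a)%:M + \tr (a * b) *: b.
  rewrite mulrA ba !mulrDl mulNr -mulrA bb mulrBr mulr1 -!scalerAl bb -scalerAr.
  rewrite scalerBr [_%:M * b]mul_scalar_mx.
  by apply: matrix2P; rewrite !mxE /= ?mulr1n ?mulr0n; ring.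
have mul_a : a * span4 a b (c0, c1, (c2, c3)) =
    span4 a b (mul_letter (\tr a) (\tr b) (\tr (a * b)) (false, false) (c0, c1, (c2, c3))).
  rewrite /span4 /= !mulrDr [_ * _%:M]mul_mx_scalar -!scalerAr aa aab.
  move: (a * b) (\tr a) (\tr b) => P x y.
  by apply: matrix2P; rewrite !mxE /= ?mulr1n ?mulr0n; ring.
have mul_b : b * span4 a b (c0, c1, (c2, c3)) =
    span4 a b (mul_letter (\tr a) (\tr b) (\tr (a * b)) (true, false) (c0, c1, (c2, c3))).
  rewrite /span4 /= !mulrDr [_ * _%:M]mul_mx_scalar -!scalerAr bab bb ba.
  move: (\tr (a * b)) (a * b) (\tr a) (\tr b) => z P x y.
  by apply: matrix2P; rewrite !mxE /= ?mulr1n ?mulr0n; ring.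
case: l => -[] []; rewrite {1}/eval_letter [X in X * _]/= ?mul_a ?mul_b //.
- rewrite inv2E // mulrBl mul_b [_%:M * _]mul_scalar_mx /span4 /=.
  move: (\tr (a * b)) (a * b) (\tr a) (\tr b) => z P x y.
  by apply: matrix2P; rewrite !mxE /= ?mulr1n ?mulr0n; ring.
- rewrite inv2E // mulrBl mul_a [_%:M * _]mul_scalar_mx /span4 /=.
  move: (\tr (a * b)) (a * b) (\tr a) (\tr b) => z P x y.
  by apply: matrix2P; rewrite !mxE /= ?mulr1n ?mulr0n; ring.
Qed.

(** The coordinates are chosen before the matrices, hence depend only on the word and the three
    traces. This yields Fricke's fact that the trace of a word is determined by the traces of a, b
    and ab. *)
Lemma eval_word_span (x y z : int) (w : word) : exists c,
  forall a b, \det a = 1 -> \det b = 1 -> \tr a = x -> \tr b = y ->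
    \tr (a * b) = z -> eval_word a b w = span4 a b c.
Proof.
elim: w => [|l w [c hc]].
  exists (1, 0, (0, 0)) => a b _ _ _ _ _.
  by rewrite eval_nil /span4 !scale0r !addr0.
exists (mul_letter x y z l c) => a b da db ta tb tab.
by rewrite eval_cons (hc a b) // eval_letter_span // ta tb tab.
Qed.

Lemma tr_eval_word (a b a' b' : 'M[int]_2) (w : word) :
  \det a = 1 -> \det b = 1 -> \det a' = 1 -> \det b' = 1 ->
  \tr a = \tr a' -> \tr b = \tr b' -> \tr (a * b) = \tr (a' * b') ->
  \tr (eval_word a b w) = \tr (eval_word a' b' w).
Proof.
move=> da db da' db' ta tb tab.
have [c hc] := eval_word_span (\tr a) (\tr b) (\tr (a * b)) w.
rewrite (hc a b) // (hc a' b') // /span4 !mxtraceD !mxtraceZ ta tb tab.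
by rewrite !mxtrace_scalar.
Qed.

(** For determinants 1 the left-hand side is 2 - tr (a b a^-1 b^-1), and this is Fricke's identity
    for the trace of a commutator. *)
Lemma det_commutator (a b : 'M[int]_2) : \det (a * b - b * a) =
  4 * \det a * \det b - \tr a ^+ 2 * \det b - \tr b ^+ 2 * \det a
  - \tr (a * b) ^+ 2 + \tr a * \tr b * \tr (a * b).
Proof.
have := mulmx2E a b; have := mulmx2E b a.
move: (a * b) (b * a) => AB BA hBA hAB.
by rewrite !tr2E !det2E !mxE !hAB !hBA; ring.
Qed.

(* With c = ab - ba one has [a, ab] = ac and [b, ab] = -cb = (b - tr b) c, so
   every commutator of elements of the span is a left multiple of c. *)
Lemma det_commutator_span (a b : 'M[int]_2) c d :
  exists k : int, \det (span4 a b c * span4 a b d - span4 a b d * span4 a b c)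
    = k * \det (a * b - b * a).
Proof.
pose m (i j : int * int * (int * int) -> int) := i c * j d - j c * i d.
pose P := m (fun c => c.1.2) (fun c => c.2.1).
pose Q := m (fun c => c.1.2) (fun c => c.2.2).
pose R := m (fun c => c.2.1) (fun c => c.2.2).
exists (\det (P%:M + Q *: a + R *: (b - (\tr b)%:M))).
rewrite -det_mulmx; congr (\det _).
rewrite /P /Q /R /m {P Q R m} /span4; case: c => -[c0 c1] [c2 c3]; case: d => -[d0 d1] [d2 d3] /=.
rewrite -[_ *m _]/(_ * _).
have hab := mulmx2E a b; have hba := mulmx2E b a.
rewrite tr2E.
move: (a * b) (b * a) hab hba => AB BA hab hba.
have subE (M N : 'M[int]_2) i j : (M - N) i j = M i j - N i j by rewrite !mxE.
by apply: matrix2P; rewrite subE !mulmx2E subE !mxE /= ?mulr1n ?mulr0n ?hab ?hba; ring.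
Qed.

(** * Reduction to a standard pair of generators *)

(** A model pair with traces 3, 3 and 6 for A, B and AB: growth of words is computed for it and
    transferred to [a], [b] through traces. *)
Definition genA : 'M[int]_2 := mat2 2 1 1 1.
Definition genB : 'M[int]_2 := mat2 1 1 1 2.

Lemma det_genA : \det genA = 1. Proof. by rewrite det2E !mat2E. Qed.
Lemma det_genB : \det genB = 1. Proof. by rewrite det2E !mat2E. Qed.
Lemma tr_genA : \tr genA = 3. Proof. by rewrite tr2E !mat2E. Qed.
Lemma tr_genB : \tr genB = 3. Proof. by rewrite tr2E !mat2E. Qed.
Lemma tr_genAB : \tr (genA * genB) = 6.
Proof. by rewrite tr2E !mulmx2E !mat2E. Qed.

Lemma mat2_mul (T : comNzRingType) (x y z t x' y' z' t' : T) :
  mat2 x y z t * mat2 x' y' z' t' =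
  mat2 (x * x' + y * z') (x * y' + y * t') (z * x' + t * z') (z * y' + t * t').
Proof. by apply: matrix2P; rewrite mulmx2E !mat2E. Qed.

Lemma mat2_inv (x y z t : int) :
  x * t - y * z = 1 -> (mat2 x y z t)^-1 = mat2 t (- y) (- z) x.
Proof.
move=> d; rewrite inv2E ?det2E ?mat2E //.
by apply: matrix2P; rewrite !mxE tr2E !mat2E /= ?mulr1n ?mulr0n; ring.
Qed.

(** With S = [mat2 0 (-1) 1 0] and T = [mat2 1 1 0 1], [genA] is the commutator of T and S, and
    [genB] that of S and T^-1. *)
Lemma Gamma_genA : Gamma genA.
Proof.
have -> : genA = mat2 1 1 0 1 * mat2 0 (-1) 1 0 * (mat2 1 1 0 1)^-1
    * (mat2 0 (-1) 1 0)^-1.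
  by rewrite !mat2_inv // !mat2_mul; congr mat2.
by apply: derived_comm; rewrite /SL2Z /= det2E !mat2E.
Qed.

Lemma Gamma_genB : Gamma genB.
Proof.
have -> : genB = mat2 0 (-1) 1 0 * mat2 1 (-1) 0 1 * (mat2 0 (-1) 1 0)^-1
    * (mat2 1 (-1) 0 1)^-1.
  by rewrite !mat2_inv // !mat2_mul; congr mat2.
by apply: derived_comm; rewrite /SL2Z /= det2E !mat2E.
Qed.

Lemma eval_word_upto_sign a b a' b' w : eq_upto_sign a a' -> eq_upto_sign b b' ->
  eq_upto_sign (eval_word a b w) (eval_word a' b' w).
Proof.
move=> ha hb; elim: w => [|x w IH]; first by rewrite !eval_nil; left.
rewrite !eval_cons; apply: upto_signM => //.
by case: x => -[] []; rewrite /eval_letter //=; apply: upto_signV.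
Qed.

Lemma normr_tr_upto_sign g h : eq_upto_sign g h -> `|\tr g| = `|\tr h|.
Proof. by case=> -> //; rewrite raddfN normrN. Qed.

Lemma tr_mul_inv (a b : 'M[int]_2) : \det a = 1 ->
  \tr (a * b) = \tr a * \tr b - \tr (a^-1 * b).
Proof.
move=> da; rewrite inv2E // mulrBl raddfB /= [_%:M * b]mul_scalar_mx mxtraceZ.
by rewrite opprB addrC subrK.
Qed.

Section Traces.
Variables a b : 'M[int]_2.
Hypotheses (hfree : free_generators a b)
  (htra : `|\tr a| = 3) (htrb : `|\tr b| = 3) (htrab : `|\tr (a^-1 * b)| = 3).

(** The hypothesis on the trace of a^-1 b leaves the values 6 and 12. For 12 the determinant of a'b'
    - b'a' would be -50, while it is 4 for the model pair. Since [a] and [b] generate [Gamma], the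
    model pair lies in the span of 1, a', b', a'b', and [det_commutator_span] would make 4 a
    multiple of 50. *)
Lemma tr_mul_neq12 a' b' : eq_upto_sign a a' -> eq_upto_sign b b' ->
  \det a' = 1 -> \det b' = 1 -> \tr a' = 3 -> \tr b' = 3 -> \tr (a' * b') != 12.
Proof.
move=> ha hb da db ta tb; apply/eqP => tab.
have span g : Gamma g -> exists c, g = span4 a' b' c.
  case: hfree => _ _ gen _ /gen[w hw].
  have [c hc] := eval_word_span 3 3 12 w.
  have [e|e] : eq_upto_sign g (span4 a' b' c).
  - by rewrite -hc //; apply: upto_sign_trans hw (eval_word_upto_sign w ha hb).
  - by exists c.
  - exists (- c.1.1, - c.1.2, (- c.2.1, - c.2.2)); rewrite e /span4 /=.
    by rewrite !scaleNr raddfN /= !opprD.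
have [c hA] := span _ Gamma_genA; have [d hB] := span _ Gamma_genB.
have [k] := det_commutator_span a' b' c d.
rewrite -hA -hB !det_commutator da db ta tb tab det_genA det_genB tr_genA.
by rewrite tr_genB tr_genAB => /eqP; lia.
Qed.

(** Changing signs makes both traces equal to 3; the trace of the product is then 6, and
    [tr_eval_word] applies. *)
Lemma normr_tr_eval_word w :
  `|\tr (eval_word a b w)| = `|\tr (eval_word genA genB w)|.
Proof.
have [a' [ha da ta]] : exists a', [/\ eq_upto_sign a a', \det a' = 1 & \tr a' = 3].
  have da : \det a = 1 by case: hfree => /Gamma_det.
  have [ta|ta] : \tr a = 3 \/ \tr a = -3 by move: htra; lia.
    by exists a; split=> //; left.
  exists (- a); split; [by right; rewrite opprK|by rewrite det2N|].
  by rewrite raddfN /= ta.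
have [b' [hb db tb]] : exists b', [/\ eq_upto_sign b b', \det b' = 1 & \tr b' = 3].
  have db : \det b = 1 by case: hfree => _ /Gamma_det.
  have [tb|tb] : \tr b = 3 \/ \tr b = -3 by move: htrb; lia.
    by exists b; split=> //; left.
  exists (- b); split; [by right; rewrite opprK|by rewrite det2N|].
  by rewrite raddfN /= tb.
have tab : \tr (a' * b') = 6.
  have := tr_mul_neq12 ha hb da db ta tb.
  have := normr_tr_upto_sign (upto_signM (upto_signV ha) hb).
  rewrite htrab (tr_mul_inv b' da) ta tb.
  by move: (\tr _) => z; lia.
rewrite (normr_tr_upto_sign (eval_word_upto_sign w ha hb)).
rewrite (tr_eval_word w da db det_genA det_genB) ?ta ?tb ?tab //.
- by rewrite tr_genA.
- by rewrite tr_genB.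
- by rewrite tr_genAB.
Qed.

Lemma normr_tr_ab : `|\tr (a * b)| = 6.
Proof.
have := normr_tr_eval_word [:: (false, false); (true, false)].
by rewrite !eval_cons !eval_nil !mulr1 /eval_letter /= tr_genAB.
Qed.

Lemma normr_tr_aVbb : `|\tr (a^-1 * b * b)| = 6.
Proof.
have := normr_tr_eval_word [:: (false, true); (true, false); (true, false)].
rewrite !eval_cons !eval_nil !mulr1 /eval_letter /= !mulrA => ->.
by rewrite mat2_inv // !mat2_mul tr2E !mat2E.
Qed.

Lemma normr_tr_bVaa : `|\tr (b^-1 * a * a)| = 6.
Proof.
have := normr_tr_eval_word [:: (true, true); (false, false); (false, false)].
rewrite !eval_cons !eval_nil !mulr1 /eval_letter /= !mulrA => ->.
by rewrite mat2_inv // !mat2_mul tr2E !mat2E.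
Qed.

End Traces.

(** * Growth of reduced words *)

(* The cone of a reduced word is determined by its first letters, the last ones
   to be applied: coneA and coneB for a^-1 and b^-1; cone1a for aa and ab^-1,
   cone2a for aba, cone3a for abb and aba^-1; cone2b for ba, cone1b for bb and
   ba^-1. *)
Inductive cone := coneA | coneB | cone1a | cone2a | cone3a | cone1b | cone2b.

Definition cone_letter (n : cone) : bool * bool :=
  match n with
  | coneA => (false, true) | coneB => (true, true)
  | cone1a | cone2a | cone3a => (false, false)
  | cone1b | cone2b => (true, false)
  end.

(** Up to sign the seven cones tile all directions of the plane. The arcs of the four letters meet
    at (1,0), (1,1), (0,1), (-1,1), the vertices of an ideal quadrilateral; (3,2), (2,3), (7,5) are
    the images of (1,1) under [genA], [genB] and [genA * genB]. *)
Definition cone_rays (n : cone) : (int * int) * (int * int) :=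
  match n with
  | coneA => ((0, 1), (-1, 1))
  | coneB => ((-1, 1), (-1, 0))
  | cone1a => ((1, 0), (3, 2))
  | cone2a => ((3, 2), (7, 5))
  | cone3a => ((7, 5), (1, 1))
  | cone2b => ((1, 1), (2, 3))
  | cone1b => ((2, 3), (0, 1))
  end.

Section Growth.
Variable R : rcfType.

Let s : R := Num.sqrt 2.

Let s2 : s * s = 2.
Proof. by rewrite -expr2 sqr_sqrtr. Qed.

(** 99/70 is a continued fraction convergent of sqrt 2, and 140/99 = 2 / (99/70). Together with [s2]
    these bounds make the later numerical checks linear. *)
Let s_bounds : 140 <= 99 * s /\ 70 * s <= 99.
Proof.
have s0 : 0 <= s by rewrite sqrtr_ge0.
by split; [have [//|h] := lerP 140 (99 * s)|have [//|h] := lerP (70 * s) 99];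
  move: s2; nra.
Qed.

(* Values on the two rays of the linear form attached to a cone. The cycle of
   cone2a and cone2b (the word abab...) admits no loss, which forces the Perron
   eigenvector there; the two cusp cycles of rays fix further values up to the
   scalar 1/6; 5/2, 6, 7/3 and 1/6 are numerical choices leaving some slack in
   all other transitions. *)
Definition cone_weight (n : cone) : R * R :=
  match n with
  | coneA => ((s - 1) * (24 / 25), 1 / 6)
  | coneB => (3 - 2 * s, (1 + s) * (25 / 144))
  | cone1a => ((s - 1) * (25 / 24), 5 / 2)
  | cone2a => ((1 + s) * (25 / 24), (3 + 2 * s) * (25 / 24))
  | cone3a => (6, (3 + 2 * s) / 6)
  | cone2b => (1, 1 + s)
  | cone1b => (7 / 3, (1 + s) * (4 / 25))
  end.

(** With k = 1 + [s] and e = 25/24 these are k e for a and k / e for b. As [s] - 1 = 1 / k, inverse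
    letters have inverse weights, so the weight of a word depends only on its exponent sums. *)
Definition letter_weight (l : bool * bool) : R :=
  match l with
  | (false, false) => (1 + s) * (25 / 24)
  | (false, true) => (s - 1) * (24 / 25)
  | (true, false) => (1 + s) * (24 / 25)
  | (true, true) => (s - 1) * (25 / 24)
  end.

(* The sign sg is there because letters only preserve the cones projectively. *)
Definition above (n : cone) (c x y : R) : Prop :=
  let r := cone_rays n in
  exists sg p q, [/\ sg = 1 \/ sg = -1, 0 <= p /\ 0 <= q,
    x = sg * (p * r.1.1%:~R + q * r.2.1%:~R),
    y = sg * (p * r.1.2%:~R + q * r.2.2%:~R)
    & c <= p * (cone_weight n).1 + q * (cone_weight n).2].

Definition word_weight (w : word) : R := \prod_(x <- w) letter_weight x.

Lemma letter_weight_gt0 l : 0 < letter_weight l.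
Proof. by case: s_bounds => lb ub; case: l => -[] []; rewrite /letter_weight; lra. Qed.

Lemma weighted_step (r c p q u1 u2 v1 v2 m11 m12 m21 m22 : R) :
  0 <= r -> 0 <= p -> 0 <= q -> c <= p * u1 + q * u2 ->
  r * u1 <= m11 * v1 + m12 * v2 -> r * u2 <= m21 * v1 + m22 * v2 ->
  r * c <= (m11 * p + m21 * q) * v1 + (m12 * p + m22 * q) * v2.
Proof.
move=> r0 p0 q0 hc h1 h2.
apply: le_trans (ler_wpM2l r0 hc) _.
have := lerD (ler_wpM2l p0 h1) (ler_wpM2l q0 h2).
by congr (_ <= _); ring.
Qed.

Definition act (l : bool * bool) (x y : R) : R * R :=
  match l with
  | (false, false) => (2 * x + y, x + y)
  | (false, true) => (x - y, - x + 2 * y)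
  | (true, false) => (x + y, x + 2 * y)
  | (true, true) => (2 * x - y, - x + y)
  end.

(** By linearity it is enough to check the two rays of the old cone: the coefficients m11, m12 and
    m21, m22 are the coordinates of their images in the rays of the new cone, up to the common sign
    [e]. *)
Lemma above_step_rows n n' l (e m11 m12 m21 m22 : R) :
  let r1 := (cone_rays n).1 in let r2 := (cone_rays n).2 in
  let v1 := (cone_rays n').1 in let v2 := (cone_rays n').2 in
  let u := cone_weight n in let u' := cone_weight n' in
  e = 1 \/ e = -1 ->
  [/\ 0 <= m11, 0 <= m12, 0 <= m21 & 0 <= m22] ->
  act l r1.1%:~R r1.2%:~R = (e * (m11 * v1.1%:~R + m12 * v2.1%:~R),
                            e * (m11 * v1.2%:~R + m12 * v2.2%:~R)) ->
  act l r2.1%:~R r2.2%:~R = (e * (m21 * v1.1%:~R + m22 * v2.1%:~R),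
                            e * (m21 * v1.2%:~R + m22 * v2.2%:~R)) ->
  letter_weight l * u.1 <= m11 * u'.1 + m12 * u'.2 ->
  letter_weight l * u.2 <= m21 * u'.1 + m22 * u'.2 ->
  forall c x y, above n c x y ->
    above n' (letter_weight l * c) (act l x y).1 (act l x y).2.
Proof.
move=> r1 r2 v1 v2 u u' he [m11_ge0 m12_ge0 m21_ge0 m22_ge0] h1 h2 w1 w2 c x y.
move=> [sg [p [q [hsg [p0 q0] -> -> hc]]]].
have lin : act l (sg * (p * r1.1%:~R + q * r2.1%:~R)) (sg * (p * r1.2%:~R + q * r2.2%:~R))
  = (sg * (p * (act l r1.1%:~R r1.2%:~R).1 + q * (act l r2.1%:~R r2.2%:~R).1),
     sg * (p * (act l r1.1%:~R r1.2%:~R).2 + q * (act l r2.1%:~R r2.2%:~R).2)).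
  by case: l {h1 h2 w1 w2} => -[] []; rewrite /act /=; congr (_, _); ring.
rewrite lin h1 h2 /=; exists (e * sg), (m11 * p + m21 * q), (m12 * p + m22 * q).
split; [|by split; rewrite addr_ge0 // mulr_ge0|rewrite -/v1 -/v2; ring|rewrite -/v1 -/v2; ring|].
  by case: he => ->; case: hsg => ->; rewrite ?mulN1r ?mul1r ?opprK; [left|right|right|left].
exact: weighted_step (ltW (letter_weight_gt0 l)) p0 q0 hc w1 w2.
Qed.

Local Ltac step n e m11 m12 m21 m22 :=
  exists n; [by []|apply: (@above_step_rows _ _ _ e m11 m12 m21 m22);
    [by [left|right] | by split; lra | rewrite /=; congr (_, _); lra
    | rewrite /=; congr (_, _); lra | rewrite /=; case: s_bounds => lb ub; move: s2; lra
    | rewrite /=; case: s_bounds => lb ub; move: s2; lra]].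

Lemma above_step n l : l != letter_inv (cone_letter n) ->
  exists2 n', cone_letter n' = l & forall c x y,
    above n c x y ->
    above n' (letter_weight l * c) (act l x y).1 (act l x y).2.
Proof.
case: n; case: l => -[] [] // _.
(* One line for each of the seven cones and the three letters that do not cancel: new cone, sign,
   then the coordinates of the images of the two rays. *)
- step coneB (1 : R) (1 : R) (0 : R) (2 : R) (1 : R).
- step cone1b (1 : R) ((1 / 2) : R) ((1 / 2) : R) (0 : R) (1 : R).
- step coneA (1 : R) (1 : R) (1 : R) (1 : R) (2 : R).
- step coneB (1 : R) (2 : R) (1 : R) (1 : R) (1 : R).
- step coneA (1 : R) (1 : R) (2 : R) (0 : R) (1 : R).
- step cone1a (-1 : R) (1 : R) (0 : R) ((1 / 2) : R) ((1 / 2) : R).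
- step coneB (-1 : R) (1 : R) (1 : R) (1 : R) (3 : R).
- step cone2b (1 : R) (1 : R) (0 : R) (1 : R) (2 : R).
- step cone1a (1 : R) ((1 / 2) : R) ((1 / 2) : R) ((1 / 2) : R) ((5 / 2) : R).
- step coneB (-1 : R) (1 : R) (3 : R) (2 : R) (7 : R).
- step cone2b (1 : R) (1 : R) (2 : R) (2 : R) (5 : R).
- step cone1a (1 : R) ((1 / 2) : R) ((5 / 2) : R) (1 : R) (6 : R).
- step coneB (-1 : R) (2 : R) (7 : R) (0 : R) (1 : R).
- step cone2b (1 : R) (2 : R) (5 : R) (0 : R) (1 : R).
- step cone1a (1 : R) (1 : R) (6 : R) (0 : R) (1 : R).
- step cone1b (1 : R) ((5 / 2) : R) ((1 / 2) : R) ((1 / 2) : R) ((1 / 2) : R).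
- step coneA (1 : R) (3 : R) (1 : R) (1 : R) (1 : R).
- step cone3a (1 : R) (1 : R) (0 : R) (0 : R) (1 : R).
- step cone1b (1 : R) (1 : R) (0 : R) ((5 / 2) : R) ((1 / 2) : R).
- step coneA (1 : R) (1 : R) (0 : R) (3 : R) (1 : R).
- step cone2a (1 : R) (1 : R) (0 : R) (0 : R) (1 : R).
Qed.

Lemma actE l (W : 'M[int]_2) j :
  act l (W 0 j)%:~R (W 1 j)%:~R =
  (((eval_letter genA genB l * W) 0 j)%:~R, ((eval_letter genA genB l * W) 1 j)%:~R).
Proof.
have -> : eval_letter genA genB l = match l with
    | (false, false) => mat2 2 1 1 1 | (false, true) => mat2 1 (-1) (-1) 2
    | (true, false) => mat2 1 1 1 2 | (true, true) => mat2 2 (-1) (-1) 1 end.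
  by case: l => -[] []; rewrite /eval_letter /= ?mat2_inv.
by case: l => -[] []; rewrite !mulmx2E !mat2E /act /=; congr (_, _); ring.
Qed.

(** Start of the ping-pong: the column [j] is chosen inside a cone of the letter. The factor 1/10 is
    harmless, as constants disappear on passing to powers. *)
Lemma above_letter x : exists n j, cone_letter n = x /\
  above n (1 / 10 * letter_weight x) (eval_letter genA genB x 0 j)%:~R
    (eval_letter genA genB x 1 j)%:~R.
Proof.
have [lb ub] := s_bounds; have h := s2.
case: x => -[] []; rewrite /eval_letter /= ?mat2_inv //.
- exists coneB, 0; rewrite !mat2E; split=> //.
  by exists (-1), 1, 1; split=> /=; [right|split|ring|ring|lra].
- exists cone1b, 1; rewrite !mat2E; split=> //.
  by exists 1, (1 / 2), (1 / 2); split=> /=; [left|split; lra|lra|lra|lra].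
- exists coneA, 1; rewrite !mat2E; split=> //.
  by exists 1, 1, 1; split=> /=; [left|split|ring|ring|lra].
- exists cone1a, 0; rewrite !mat2E; split=> //.
  by exists 1, (1 / 2), (1 / 2); split=> /=; [left|split; lra|lra|lra|lra].
Qed.

Lemma above_reduced x w : reduced (x :: w) -> exists n j, cone_letter n = x /\
  above n (1 / 10 * word_weight (x :: w)) (eval_word genA genB (x :: w) 0 j)%:~R
    (eval_word genA genB (x :: w) 1 j)%:~R.
Proof.
elim: w x => [|y w IH] x.
  have [n [j [hn hj]]] := above_letter x.
  by exists n, j; rewrite eval_cons eval_nil mulr1 /word_weight big_seq1.
move=> /andP[yx /IH[n [j [hn hj]]]].
have [|n' hn' step] := @above_step n x.
  by rewrite hn; apply: contraNneq yx => ->; case: (y) => ? ? /=; rewrite negbK.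
exists n', j; split=> //; move: (step _ _ _ hj).
rewrite actE -eval_cons /word_weight [in X in _ -> X]big_cons.
by rewrite mulrCA.
Qed.

Lemma above_le n c x y : above n c x y -> c <= 7 * (`|x| + `|y|).
Proof.
have [lb ub] := s_bounds.
move=> [sg [p [q [hsg [p0 q0] -> -> hc]]]].
have sg1 : `|sg| = 1 by case: hsg => ->; rewrite ?normrN normr1.
rewrite !normrM sg1 !mul1r; apply: le_trans hc _.
have u1 : (cone_weight n).1 <= 7 by case: n {sg hsg sg1}; rewrite /=; lra.
have u2 : (cone_weight n).2 <= 7 by case: n {sg hsg sg1 u1}; rewrite /=; lra.
have h1 := ler_wpM2l p0 u1; have h2 := ler_wpM2l q0 u2.
(* 7 bounds all cone weights, the largest being (3 + 2 [s]) * 25/24, about 6.07. It remains to bound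
   p + q by the 1-norm of the vector, cone by cone. *)
apply: (@le_trans _ _ (7 * (p + q))); first by move: h1 h2; lra.
rewrite ler_pM2l //.
have le_normN (z : R) : - z <= `|z| by rewrite -normrN ler_norm.
set X := _ + _ * (cone_rays n).2.1%:~R; set Y := _ + _ * (cone_rays n).2.2%:~R.
have := ler_norm X; have := ler_norm Y; have := le_normN X.
by rewrite /X /Y; case: n {hsg sg1 u1 u2 h1 h2 X Y} => /=; lra.
Qed.

(** 1/140 is the product of 1/10 from the first letter, 1/7 from [above_le], and 1/2 for keeping the
    larger of the two entries of a column. *)
Lemma entry_ge_reduced w : reduced w ->
  exists i j, 1 / 140 * word_weight w <= `|(eval_word genA genB w i j)%:~R|.
Proof.
case: w => [_|x w /above_reduced[n [j [_ /above_le h]]]].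
  by exists 0, 0; rewrite eval_nil mxE /word_weight big_nil normr1; lra.
move: h; set c := word_weight _; set X := `|_|; set Y := `|_| => h.
have [hX|hX] := lerP (1 / 140 * c) X; first by exists 0, j.
by exists 1, j; rewrite -/Y; lra.
Qed.

Lemma letter_weight_inv x : letter_weight (letter_inv x) = (letter_weight x)^-1.
Proof.
have h := s2; have nz := lt0r_neq0 (letter_weight_gt0 x).
apply: (mulIf nz); rewrite mulVf // {nz}; case: x => -[] []; rewrite /=; lra.
Qed.

(** Cancelling a letter against its inverse changes neither the matrix nor the weight, so the
    estimate extends to all words. *)
Lemma reduce_word w : exists2 w', reduced w' &
  eval_word genA genB w' = eval_word genA genB w /\ word_weight w' = word_weight w.
Proof.
elim: w => [|x w [w' rw' [ew cw]]]; first by exists [::].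
have uA := det_genA; have uB := det_genB.
case: w' => [|y w'] in rw' ew cw *.
  by exists [:: x] => //; rewrite !eval_cons ew /word_weight !big_cons -/(word_weight w) -cw.
have [yx|yx] := eqVneq y (letter_inv x); last first.
  exists [:: x, y & w']; first by rewrite /reduced /= yx.
  by rewrite eval_cons ew eval_cons /word_weight big_cons -/(word_weight (y :: w')) cw big_cons.
exists w'; first by move: rw'; rewrite /reduced /=; exact: path_sorted.
rewrite eval_cons -ew eval_cons yx eval_letter_inv mulVKr ?eval_letter_unit //.
split=> //; rewrite [RHS]/word_weight big_cons -/(word_weight w) -cw yx.
rewrite /word_weight big_cons letter_weight_inv mulVKf //.
by rewrite lt0r_neq0 ?letter_weight_gt0.
Qed.

Lemma entry_ge w :
  exists i j, 1 / 140 * word_weight w <= `|(eval_word genA genB w i j)%:~R|.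
Proof. by have [w' /entry_ge_reduced h [<- <-]] := reduce_word w. Qed.

Definition weight_a : R := (1 + s) * (25 / 24).
Definition weight_b : R := (1 + s) * (24 / 25).

Lemma weight_a_gt0 : 0 < weight_a.
Proof. by rewrite (letter_weight_gt0 (false, false)). Qed.

Lemma weight_b_gt0 : 0 < weight_b.
Proof. by rewrite (letter_weight_gt0 (true, false)). Qed.

Lemma weight_b_lt_a : weight_b < weight_a.
Proof. by case: s_bounds => lb _; rewrite /weight_a /weight_b; lra. Qed.

Lemma weight_ab_gt1 : 1 < weight_a * weight_b.
Proof. by case: s_bounds => lb _; rewrite /weight_a /weight_b; move: s2; lra. Qed.

(** The larger root of X^2 - 6 X + 1 is 3 + 2 sqrt 2 = k^2, the product of the two weights, in which
    e cancels. It is the value of [expR (l / 2)] for a curve of length l and trace 6. *)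
Lemma root6_le x : x * x + 1 = 6 * x -> x <= weight_a * weight_b.
Proof.
case: s_bounds => lb _ h; rewrite leNgt; apply/negP.
have -> : weight_a * weight_b = 3 + 2 * s.
  by rewrite /weight_a /weight_b; move: s2; lra.
by move: s2 => h2 h3; nra.
Qed.

Lemma word_weightE w :
  word_weight w = weight_a ^ (word_class w).1 * weight_b ^ (word_class w).2.
Proof.
have na := lt0r_neq0 weight_a_gt0; have nb := lt0r_neq0 weight_b_gt0.
elim: w => [|x w IH]; first by rewrite /word_weight /word_class !big_nil mulr1.
rewrite /word_weight /word_class !big_cons -/(word_weight w) -/(word_class w) IH.
rewrite [(_ + _).1]/= [(_ + _).2]/= !expfzDr //.
have := letter_weight_inv (x.1, false).
case: x => -[] []; rewrite /letter_class /= ?oppr0 ?expr0z ?expr1z ?exprN1 => h;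
  rewrite ?h /weight_a /weight_b; ring.
Qed.

Definition swap_letter (x : bool * bool) : bool * bool := (~~ x.1, x.2).

(** Conjugation by the permutation matrix, which exchanges [genA] and [genB]. It gives the growth
    bound with the exponent sums exchanged, hence |m - n| in place of m - n. *)
Definition swap2 (M : 'M[int]_2) := mat2 (M 1 1) (M 1 0) (M 0 1) (M 0 0).

Lemma swap2M M N : swap2 (M * N) = swap2 M * swap2 N.
Proof. by rewrite /swap2 mat2_mul !mulmx2E; congr mat2; ring. Qed.

Lemma eval_swap w :
  eval_word genA genB (map swap_letter w) = swap2 (eval_word genA genB w).
Proof.
elim: w => [|x w IH].
  by rewrite /= !eval_nil; apply: matrix2P; rewrite mat2E !mxE.
rewrite /= !eval_cons IH swap2M; congr (_ * _).
by case: x => -[] []; rewrite /eval_letter /= ?mat2_inv // /swap2 !mat2E.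
Qed.

Lemma word_class_swap w :
  word_class (map swap_letter w) = ((word_class w).2, (word_class w).1).
Proof.
elim: w => [|x w IH]; first by rewrite /word_class !big_nil.
rewrite /word_class /= !big_cons -!/(word_class _) IH.
by case: x => -[] [].
Qed.

Lemma entry_ge_swap w : exists i j,
  1 / 140 * (weight_a ^ (word_class w).2 * weight_b ^ (word_class w).1)
    <= `|(eval_word genA genB w i j)%:~R|.
Proof.
have [i [j]] := entry_ge (map swap_letter w).
rewrite word_weightE word_class_swap eval_swap /= /swap2 !mxE.
by case: ifP => _; case: ifP => _ h; do 2!eexists; exact: h.
Qed.

End Growth.

(** * Lengths of closed geodesics *)

Section Lengths.
Variable R : realType.
Implicit Types (g W : 'M[int]_2) (r l : R).

Lemma geodesic_length_ge0 g : 0 <= geodesic_length R g.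
Proof. by rewrite /geodesic_length; case: xgetP => // x _ []. Qed.

Lemma geodesic_lengthP g : hyperbolic g ->
  expR (geodesic_length R g / 2) + expR (- (geodesic_length R g / 2))
    = `|(\tr g)%:~R|.
Proof.
move=> hg; suff: exists l : R, 0 <= l /\
    expR (l / 2) + expR (- (l / 2)) = `|(\tr g)%:~R| by case/(xgetPex 0).
set t : R := `|_|.
have t2 : 2 <= t by rewrite /t -intr_norm (ler_int _ 2) ltW.
have t4 : 0 <= t ^+ 2 - 4 by nra.
(* The larger root of X^2 - t X + 1. *)
pose x := (t + Num.sqrt (t ^+ 2 - 4)) / 2.
have sx := sqr_sqrtr t4; have s0 := sqrtr_ge0 (t ^+ 2 - 4).
have x1 : 1 <= x by rewrite /x; lra.
have x0 : 0 < x by lra.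
exists (2 * ln x); split; first by rewrite mulr_ge0 // ln_ge0.
rewrite mulrAC divff // mul1r expRN lnK ?posrE //.
apply: (mulIf (lt0r_neq0 x0)); rewrite mulrDl mulVf ?lt0r_neq0 // /x.
by move: sx s0; set u := Num.sqrt _ => sx s0; nra.
Qed.

Lemma geodesic_length_gt0 g : hyperbolic g -> 0 < geodesic_length R g.
Proof.
move=> hg; rewrite lt_def geodesic_length_ge0 andbT; apply/eqP => l0.
have := geodesic_lengthP hg; rewrite l0 mul0r oppr0 expR0.
move: hg; rewrite /hyperbolic -intr_norm -(ltr_int R) => hg.
by move: hg => /[swap] <-; lra.
Qed.

Lemma linear_rec_bound (y : nat -> R) (x : R) : 1 < `|x| ->
  (forall k, y k.+2 = (x + x^-1) * y k.+1 - y k) ->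
  exists D, forall k, `|y k| <= D * `|x| ^+ k.
Proof.
move=> x1 rec; have x0 : 0 < `|x| by lra.
have nx : x != 0 by rewrite -normr_gt0.
have gap : 0 < `|x| - `|x|^-1.
  have h : `|x|^-1 < 1 by rewrite invf_lt1.
  by rewrite subr_gt0 (lt_trans h).
(* Splitting off the root 1/x of the recurrence leaves a geometric sequence of ratio x. *)
have dy k : y k.+1 = x^-1 * y k + x ^+ k * (y 1%N - x^-1 * y 0).
  elim: k => [|k IH]; first by rewrite expr0; ring.
  move: (congr1 ( *%R x) IH); rewrite mulrDr [x * (x^-1 * _)]mulrA divff // mul1r.
  rewrite rec exprS -mulrA mulrDl => hE.
  by rewrite hE; ring.
set e := y 1%N - _ in dy.
(* Chosen so that D / |x| + |e| <= D |x|, which carries the induction. *)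
exists (`|y 0| + `|e| / (`|x| - `|x|^-1)) => k; set D := _ + _.
have hD : `|e| <= D * (`|x| - `|x|^-1).
  by rewrite /D mulrDl divfK ?lt0r_neq0 // lerDr mulr_ge0 // ltW.
elim: k => [|k IH].
  by rewrite expr0 mulr1 /D lerDl divr_ge0 // ltW.
rewrite dy; apply: le_trans (ler_normD _ _) _; rewrite !normrM normfV normrX.
have xV : 0 <= `|x|^-1 by rewrite invr_ge0.
apply: le_trans (lerD (ler_wpM2l xV IH) (ler_wpM2l (exprn_ge0 k (ltW x0)) hD)) _.
by rewrite exprS le_eqVlt; apply/orP; left; apply/eqP; ring.
Qed.

Lemma mx_pow_bound W (x : R) i j : \det W = 1 -> 1 < x ->
  x + x^-1 = `|(\tr W)%:~R| ->
  exists D : R, forall k, `|((W ^+ k) i j)%:~R| <= D * x ^+ k.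
Proof.
move=> dW x1 hx; have x0 : 0 <= x by lra.
(* The dominant eigenvalue has the sign of the trace. *)
pose x' := if 0 <= ((\tr W)%:~R : R) then x else - x.
have nx' : `|x'| = x by rewrite /x'; case: ifP => _; rewrite ?normrN ger0_norm.
have tx' : x' + x'^-1 = (\tr W)%:~R.
  rewrite /x'; case: lerP hx => [h|h]; first by rewrite ger0_norm.
  by rewrite ltr0_norm // invrN -opprD => ->; rewrite opprK.
have [||D hD] := @linear_rec_bound (fun k => ((W ^+ k) i j)%:~R) x'.
- by rewrite nx'.
- move=> k; rewrite tx' !(exprSr W) -mulrA cayley2 dW mulrBr mulr1 -scalerAr.
  by rewrite !mxE rmorphB rmorphM.
- by exists D => k; rewrite -nx'.
Qed.

(** Otherwise the powers of r / x, which are at most D / C, would be unbounded by Bernoulli's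
    inequality. *)
Lemma le_of_pow_le (C D r x : R) : 0 < C -> 0 < x ->
  (forall k, C * r ^+ k <= D * x ^+ k) -> r <= x.
Proof.
move=> C0 x0 h; rewrite leNgt; apply/negP => xr.
pose q := r / x; have q1 : 0 < q - 1 by rewrite subr_gt0 ltr_pdivlMr ?mul1r.
have bernoulli k : 1 + k%:R * (q - 1) <= q ^+ k.
  elim: k => [|k IH]; first by rewrite expr0 mul0r addr0.
  rewrite exprS -natr1.
  have q0 : 0 <= q by lra.
  apply: le_trans (ler_wpM2l q0 IH).
  have : 0 <= k%:R * (q - 1) * (q - 1) by rewrite !mulr_ge0 // ltW.
  by lra.
have hq k : C * (k%:R * (q - 1)) <= D.
  have xk : 0 < x ^+ k by rewrite exprn_gt0.
  have : C * q ^+ k <= D.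
    by rewrite /q expr_div_n mulrA ler_pdivrMr.
  apply: le_trans; rewrite ler_pM2l //; have := bernoulli k; lra.
have D0 : 0 <= D by have := hq 0; rewrite mul0r mulr0.
have := archi_boundP (divr_ge0 D0 (ltW (mulr_gt0 C0 q1))).
set k := Num.bound _; rewrite ltr_pdivrMr ?mulr_gt0 // => hk.
by have := hq k; lra.
Qed.

(** ln (k e), next to ln (k / e) for [beta]: their sum is 2 ln k and their difference 2 ln e, where
    e = 25/24. *)
Definition alpha : R := ln (weight_a R).
Definition beta : R := ln (weight_b R).

Lemma beta_lt_alpha : beta < alpha.
Proof. by rewrite ltr_ln ?posrE ?weight_a_gt0 ?weight_b_gt0 ?weight_b_lt_a. Qed.

Lemma expR_alphaDbeta : expR (alpha + beta) = weight_a R * weight_b R.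
Proof. by rewrite expRD !lnK ?posrE ?weight_a_gt0 ?weight_b_gt0. Qed.

Lemma alphaDbeta_gt0 : 0 < alpha + beta.
Proof. by rewrite -expR_gt1 expR_alphaDbeta weight_ab_gt1. Qed.

Lemma geodesic_length_tr6 g : `|\tr g| = 6 ->
  geodesic_length R g <= 2 * (alpha + beta).
Proof.
move=> tg; have hg : hyperbolic g by rewrite /hyperbolic tg.
have := geodesic_lengthP hg; rewrite -intr_norm tg expRN.
set l := geodesic_length R g => hl.
suff : expR (l / 2) <= expR (alpha + beta) by rewrite ler_expR; lra.
rewrite expR_alphaDbeta; apply: root6_le; move: hl (expR_gt0 (l / 2)).
set x := expR _ => hl x0; move: hl => /(congr1 ( *%R x)).
by rewrite mulrDr divff ?lt0r_neq0 // => ->; rewrite mulrC.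
Qed.

Lemma expR_exprz (x : R) (m : int) : expR x ^ m = expR (m%:~R * x).
Proof.
case: m => n; first by rewrite -exprnP -expRM_natl.
by rewrite NegzE -exprnN rmorphN mulNr expRN -expRM_natl.
Qed.

Definition weight_exp (h : int * int) : R := h.1%:~R * alpha + h.2%:~R * beta.

Lemma weight_expE (h : int * int) :
  weight_a R ^ h.1 * weight_b R ^ h.2 = expR (weight_exp h).
Proof.
rewrite /weight_exp expRD -!expR_exprz.
by rewrite !lnK ?posrE ?weight_a_gt0 ?weight_b_gt0.
Qed.

Lemma weight_expMn h k : weight_exp (h *+ k) = k%:R * weight_exp h.
Proof.
have -> : h *+ k = (h.1 *+ k, h.2 *+ k).
  by elim: k => [|k IH]; rewrite ?mulr0n // !mulrS IH.
by rewrite /weight_exp /= !rmorphMn /= !mulrnAl mul1r mulrnDl.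
Qed.

Lemma eval_pow a b w k : eval_word a b (flatten (nseq k w)) = eval_word a b w ^+ k.
Proof.
by elim: k => [|k IH]; rewrite /= ?eval_nil // eval_cat IH exprS.
Qed.

Lemma word_class_pow w k : word_class (flatten (nseq k w)) = word_class w *+ k.
Proof.
elim: k => [|k IH]; first by rewrite /word_class big_nil mulr0n.
by rewrite /= word_class_cat IH mulrS.
Qed.

Lemma eval_det a b w : \det a = 1 -> \det b = 1 -> \det (eval_word a b w) = 1.
Proof.
move=> da db; elim: w => [|x w IH]; first by rewrite eval_nil det1.
rewrite eval_cons det_mulmx IH mulr1.
by case: x => -[] []; rewrite /eval_letter //= det_inv.
Qed.

Lemma expR_ge_of_entries w (x r : R) :
  1 < x -> x + x^-1 = `|(\tr (eval_word genA genB w))%:~R| ->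
  (forall k, exists i j,
    1 / 140 * expR r ^+ k <= `|((eval_word genA genB w ^+ k) i j)%:~R|) ->
  expR r <= x.
Proof.
move=> x1 hx hr; have x0 : 0 < x by lra.
have dW := eval_det w det_genA det_genB.
have /choice[D hD] : forall ij : 'I_2 * 'I_2, exists D : R, forall k,
    `|((eval_word genA genB w ^+ k) ij.1 ij.2)%:~R| <= D * x ^+ k.
  by move=> ij; apply: mx_pow_bound.
(* The position of the large entry varies with the exponent, so the constants of all four entries
   are added up. *)
apply: (@le_of_pow_le (1 / 140) (\sum_ij `|D ij|)) => // k.
have [i [j /le_trans-> //]] := hr k.
apply: le_trans (hD (i, j) k) _; rewrite ler_pM2r ?exprn_gt0 //.
rewrite (bigD1 (i, j)) //= (le_trans (ler_norm _)) // lerDl.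
by apply: sumr_ge0.
Qed.

(** Applied to powers of a word for [g]: some entry of the k-th power is at least 1/140 times the
    k-th power of the weight, and all are at most a constant times [expR (l / 2) ^+ k], with l the
    length. Comparing growth rates removes the constants. *)
Lemma geodesic_length_ge a b g h : free_generators a b ->
  `|\tr a| = 3 -> `|\tr b| = 3 -> `|\tr (a^-1 * b)| = 3 ->
  hyperbolic g -> homology_class a b g h ->
  2 * weight_exp h <= geodesic_length R g /\
  2 * weight_exp (h.2, h.1) <= geodesic_length R g.
Proof.
move=> hfree ta tb tab hg /(homology_class_word hfree)[w gw cw].
have := geodesic_lengthP hg; rewrite expRN.
rewrite -intr_norm (normr_tr_upto_sign gw) (normr_tr_eval_word hfree ta tb tab).
rewrite intr_norm => hx.
have x1 : 1 < expR (geodesic_length R g / 2).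
  by rewrite expR_gt1 divr_gt0 // geodesic_length_gt0.
have H r : expR r <= expR (geodesic_length R g / 2) -> 2 * r <= geodesic_length R g.
  by rewrite ler_expR; lra.
split; apply: H; apply: expR_ge_of_entries x1 hx _ => k; rewrite -eval_pow.
- have [i [j]] := entry_ge R (flatten (nseq k w)).
  rewrite word_weightE weight_expE word_class_pow cw weight_expMn expRM_natl.
  by exists i, j.
- have [i [j]] := entry_ge_swap R (flatten (nseq k w)).
  rewrite (weight_expE (_, _)) word_class_pow cw.
  have -> : ((h *+ k).2, (h *+ k).1) = (h.2, h.1) *+ k.
    by elim: k => [|k IH]; rewrite ?mulr0n // !mulrS -IH.
  by rewrite weight_expMn expRM_natl; exists i, j.
Qed.

End Lengths.

(** * Lengths of multicurves *)

Section Multicurves.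
Variables (R : realType) (a b : 'M[int]_2).
Hypotheses (hfree : free_generators a b)
  (htra : `|\tr a| = 3) (htrb : `|\tr b| = 3) (htrab : `|\tr (a^-1 * b)| = 3).

Let Ga : Gamma a. Proof. by case: hfree. Qed.
Let Gb : Gamma b. Proof. by case: hfree. Qed.
Let ua : a \is a GRing.unit. Proof. by rewrite unitmxE (Gamma_det Ga) unitr1. Qed.
Let ub : b \is a GRing.unit. Proof. by rewrite unitmxE (Gamma_det Gb) unitr1. Qed.

Let lengths h : set R :=
  [set \sum_(g <- c) geodesic_length R g | c in [set c | represents a b c h]].

Let lengths_lb h : lbound (lengths h) 0.
Proof. by move=> _ [c _ <-]; apply: sumr_ge0 => g _; apply: geodesic_length_ge0. Qed.

Let lengths_has_lb h : has_lbound (lengths h).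
Proof. by exists 0; apply: lengths_lb. Qed.

Lemma represents_cat c d h k : represents a b c h -> represents a b d k ->
  represents a b (c ++ d) (h + k).
Proof.
move=> hc hd; elim: hc => [|g c' h' k' Gg hg cg _ IH]; first by rewrite add0r.
by rewrite -addrA; apply: represents_cons.
Qed.

Lemma represents1 g h : Gamma g -> hyperbolic g -> homology_class a b g h ->
  represents a b [:: g] h.
Proof.
by move=> Gg hg cg; rewrite -[h]addr0; apply: represents_cons => //; apply: represents_nil.
Qed.

Lemma represents_mulrn c h n : represents a b c h ->
  exists d, represents a b d (h *+ n).
Proof.
move=> hc; elim: n => [|n [d hd]]; first by exists [::]; apply: represents_nil.
by exists (c ++ d); rewrite mulrS; apply: represents_cat.
Qed.

Lemma class_a : homology_class a b a (1, 0).
Proof. by rewrite /homology_class expr1z expr0z mulr1 divrr //; apply: derived1. Qed.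

Lemma class_b : homology_class a b b (0, 1).
Proof. by rewrite /homology_class expr1z expr0z mul1r divrr //; apply: derived1. Qed.

Lemma class_aV : homology_class a b a^-1 (-1, 0).
Proof.
by rewrite /homology_class exprN1 expr0z mulr1 divrr ?unitrV //; apply: derived1.
Qed.

Lemma class_bV : homology_class a b b^-1 (0, -1).
Proof.
by rewrite /homology_class exprN1 expr0z mul1r divrr ?unitrV //; apply: derived1.
Qed.

Lemma class_ab : homology_class a b (a * b) (1, 1).
Proof.
by rewrite /homology_class !expr1z divrr ?unitrMl //; apply: derived1.
Qed.

Lemma class_aVbb : homology_class a b (a^-1 * b * b) (-1, 2).
Proof.
rewrite /homology_class /= exprN1 -exprnP expr2 -mulrA divrr ?unitrMl ?unitrV //.
exact: derived1.
Qed.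

Lemma class_bVaa : homology_class a b (b^-1 * a * a) (2, -1).
Proof.
rewrite /homology_class /= exprN1 -exprnP expr2.
(* The class is measured against a^2 b^-1; the discrepancy is the commutator of b^-1 and a^2. *)
have -> : b^-1 * a * a * (a * a * b^-1)^-1 =
    b^-1 * (a * a) * (b^-1)^-1 * (a * a)^-1.
  by rewrite invrM ?unitrMl ?unitrV // !mulrA.
by apply: derived_comm; [exact: Gamma_inv | exact: derivedM].
Qed.

Lemma hyperbolic3 g : `|\tr g| = 3 -> hyperbolic g.
Proof. by rewrite /hyperbolic => ->. Qed.

Lemma hyperbolic6 g : `|\tr g| = 6 -> hyperbolic g.
Proof. by rewrite /hyperbolic => ->. Qed.

Lemma tr_inv (g : 'M[int]_2) : \det g = 1 -> \tr g^-1 = \tr g.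
Proof. by move=> dg; rewrite inv2E // raddfB /= mxtrace_scalar mulr2n addrK. Qed.

Let ra : represents a b [:: a] (1, 0).
Proof. by apply: represents1 class_a => //; apply: hyperbolic3. Qed.
Let rb : represents a b [:: b] (0, 1).
Proof. by apply: represents1 class_b => //; apply: hyperbolic3. Qed.
Let raV : represents a b [:: a^-1] (-1, 0).
Proof.
apply: represents1 class_aV; first exact: Gamma_inv.
by apply: hyperbolic3; rewrite tr_inv ?Gamma_det.
Qed.
Let rbV : represents a b [:: b^-1] (0, -1).
Proof.
apply: represents1 class_bV; first exact: Gamma_inv.
by apply: hyperbolic3; rewrite tr_inv ?Gamma_det.
Qed.

Lemma pair_int_decomp (h : int * int) : exists m n : nat, exists e f : bool,
  [/\ `|h.1| = m%:Z, `|h.2| = n%:Z &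
  h = (if e then (1, 0) else (-1, 0)) *+ m + (if f then (0, 1) else (0, -1)) *+ n].
Proof.
have mulp (x : int * int) k : x *+ k = (x.1 *+ k, x.2 *+ k).
  by elim: k => [|k IH]; rewrite ?mulr0n // !mulrS IH.
case: h => x y /=; exists `|x|%N, `|y|%N, (0 <= x), (0 <= y).
split; [by rewrite abszE|by rewrite abszE|].
by case: (lerP 0 x) => hx; case: (lerP 0 y) => hy; rewrite !mulp;
  congr (_, _); rewrite /= ?mul0rn; lia.
Qed.

(** Makes the set of lengths nonempty, so that the [inf] in [ellZ] is a genuine infimum and not a
    default value. *)
Lemma represents_exists h : exists c, represents a b c h.
Proof.
have [m [n [e [f [_ _ ->]]]]] := pair_int_decomp h.
have [c hc] : exists c, represents a b c ((if e then (1, 0) else (-1, 0)) *+ m).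
  by case: e; [apply: represents_mulrn ra|apply: represents_mulrn raV].
have [d hd] : exists d, represents a b d ((if f then (0, 1) else (0, -1)) *+ n).
  by case: f; [apply: represents_mulrn rb|apply: represents_mulrn rbV].
by exists (c ++ d); apply: represents_cat.
Qed.

Let lengths_neq0 h : nonempty (lengths h).
Proof. by have [c hc] := represents_exists h; exists (\sum_(g <- c) geodesic_length R g), c. Qed.

Lemma ellZ_ge0 h : 0 <= ellZ R a b h.
Proof. exact: lb_le_inf (lengths_neq0 h) (@lengths_lb h). Qed.

Lemma ellZ_le c h : represents a b c h ->
  ellZ R a b h <= \sum_(g <- c) geodesic_length R g.
Proof. by move=> hc; apply: (ge_inf (lengths_has_lb h)); exists c. Qed.

Lemma ellZD h k : ellZ R a b (h + k) <= ellZ R a b h + ellZ R a b k.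
Proof.
rewrite -lerBlDr; apply: (lb_le_inf (lengths_neq0 h)) => _ [c hc <-].
rewrite lerBlDr -lerBlDl; apply: (lb_le_inf (lengths_neq0 k)) => _ [d hd <-].
rewrite lerBlDl -big_cat; apply: ellZ_le; exact: represents_cat.
Qed.

Lemma ellZ0 : ellZ R a b 0 = 0.
Proof.
apply/eqP; rewrite eq_le ellZ_ge0 andbT.
by rewrite (le_trans (ellZ_le (represents_nil a b))) ?big_nil.
Qed.

Lemma ellZMn h n : ellZ R a b (h *+ n) <= n%:R * ellZ R a b h.
Proof.
elim: n => [|n IH]; first by rewrite mulr0n ellZ0 mul0r.
by rewrite mulrS -nat1r mulrDl mul1r (le_trans (ellZD _ _)) // lerD2l.
Qed.

Lemma ellZ_le_geodesic g h : Gamma g -> hyperbolic g -> homology_class a b g h ->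
  ellZ R a b h <= geodesic_length R g.
Proof.
by move=> Gg hg cg; have := ellZ_le (represents1 Gg hg cg); rewrite big_seq1.
Qed.

Lemma ellZ_11 : ellZ R a b (1, 1) <= 2 * (alpha R + beta R).
Proof.
have t6 := normr_tr_ab hfree htra htrb htrab.
apply: le_trans (ellZ_le_geodesic _ (hyperbolic6 t6) class_ab) (geodesic_length_tr6 R t6).
exact: derivedM.
Qed.

Lemma ellZ_N12 : ellZ R a b (-1, 2) <= 2 * (alpha R + beta R).
Proof.
have t6 := normr_tr_aVbb hfree htra htrb htrab.
apply: le_trans (ellZ_le_geodesic _ (hyperbolic6 t6) class_aVbb) (geodesic_length_tr6 R t6).
by do 2?apply: derivedM => //; apply: Gamma_inv.
Qed.

Lemma ellZ_2N1 : ellZ R a b (2, -1) <= 2 * (alpha R + beta R).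
Proof.
have t6 := normr_tr_bVaa hfree htra htrb htrab.
apply: le_trans (ellZ_le_geodesic _ (hyperbolic6 t6) class_bVaa) (geodesic_length_tr6 R t6).
by do 2?apply: derivedM => //; apply: Gamma_inv.
Qed.

(** Both lower bounds are additive in the class, so those of the components add up over a
    multicurve. *)
Lemma ellZ_ge h : 2 * weight_exp R h <= ellZ R a b h /\
  2 * weight_exp R (h.2, h.1) <= ellZ R a b h.
Proof.
have wD u v : weight_exp R (u + v) = weight_exp R u + weight_exp R v.
  by rewrite /weight_exp !rmorphD /= !mulrDl addrACA.
have H c : represents a b c h ->
    2 * weight_exp R h <= \sum_(g <- c) geodesic_length R g /\
    2 * weight_exp R (h.2, h.1) <= \sum_(g <- c) geodesic_length R g.
  elim=> [|g d u v Gg hg cg _ [IH1 IH2]].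
    by rewrite big_nil /weight_exp /= !mul0r addr0 mulr0.
  have [h1 h2] := geodesic_length_ge R hfree htra htrb htrab hg cg.
  rewrite big_cons; split; first by rewrite wD mulrDr lerD.
  by rewrite (wD (u.2, u.1) (v.2, v.1)) mulrDr lerD.
by split; apply: (lb_le_inf (lengths_neq0 h)) => _ [c /H[h1 h2] <-].
Qed.

(** Every class is a sum of |h.1| + |h.2| classes of the form (1,0), (-1,0), (0,1), (0,-1), and L is
    the sum of the values of [ellZ] at these four. *)
Lemma ellZ_norm1_bound : exists2 L : R, 0 <= L &
  forall h, ellZ R a b h <= L * (`|h.1%:~R| + `|h.2%:~R|).
Proof.
pose l x := ellZ R a b x.
pose L := l (1, 0) + l (-1, 0) + (l (0, 1) + l (0, -1)).
have l0 x : 0 <= l x by apply: ellZ_ge0.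
exists L; first by rewrite !addr_ge0.
move=> h; have [m [n [e [f [hm hn hh]]]]] := pair_int_decomp h.
rewrite -!intr_norm hm hn {1}hh mulrDr.
have lx x k : l x <= L -> l (x *+ k) <= L * k%:R.
  by move=> xL; rewrite (le_trans (ellZMn _ _)) // mulrC ler_wpM2r.
have := l0 (1, 0); have := l0 (-1, 0); have := l0 (0, 1); have := l0 (0, -1).
move=> l4 l3 l2 l1.
rewrite (le_trans (ellZD _ _)) // lerD // lx //.
- by case: e {hh}; rewrite /L; lra.
- by case: f {hh}; rewrite /L; lra.
Qed.

End Multicurves.

(** * Stable norm of a subadditive function *)

Section StableNorm.
Variables (R : realType) (f : int * int -> R) (L : R).
Hypotheses (f_ge0 : forall h, 0 <= f h) (f0 : f 0 = 0)
  (fD : forall h k, f (h + k) <= f h + f k)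
  (L_ge0 : 0 <= L) (f_le : forall h, f h <= L * (`|h.1%:~R| + `|h.2%:~R|)).

Definition dist1 (u v : R * R) : R := `|u.1 - v.1| + `|u.2 - v.2|.

Lemma dist1_ge0 u v : 0 <= dist1 u v.
Proof. by rewrite addr_ge0. Qed.

Lemma dist1_triangle u v w : dist1 u w <= dist1 u v + dist1 v w.
Proof.
rewrite /dist1 addrACA lerD //.
- by rewrite -[u.1 - w.1](subrKA v.1) ler_normD.
- by rewrite -[u.2 - w.2](subrKA v.2) ler_normD.
Qed.

Lemma dist1xx u : dist1 u u = 0.
Proof. by rewrite /dist1 !subrr normr0 addr0. Qed.

(** The point h / (n + 1); the shift keeps the denominator positive. *)
Definition fracv (h : int * int) (n : nat) : R * R :=
  (h.1%:~R / n.+1%:R, h.2%:~R / n.+1%:R).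

Definition approx (v : R * R) (h : int * int) (n : nat) : R :=
  f h / n.+1%:R + L * dist1 v (fracv h n).

(* The largest L-Lipschitz minorant of h / n |-> f h / n; it agrees with the
   stable norm lim f (n h) / n of f. *)
Definition stable (v : R * R) : R :=
  inf [set approx v x.1 x.2 | x in [set: (int * int) * nat]]%classic.

Let approx_ge0 v h n : 0 <= approx v h n.
Proof. by rewrite addr_ge0 ?divr_ge0 ?mulr_ge0 ?dist1_ge0. Qed.

Lemma stable_le v h n : stable v <= approx v h n.
Proof.
apply: ge_inf; last by exists (h, n).
by exists 0 => _ [x _ <-]; apply: approx_ge0.
Qed.

Lemma le_stable v x : (forall h n, x <= approx v h n) -> x <= stable v.
Proof.
move=> hx; apply: lb_le_inf; first by exists (approx v 0 0), (0, 0%N).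
by move=> _ [[h n] _ <-].
Qed.

Lemma stable_fracv h n : stable (fracv h n) <= f h / n.+1%:R.
Proof. by rewrite (le_trans (stable_le _ h n)) // /approx dist1xx mulr0 addr0. Qed.

Lemma stable_int h : stable (h.1%:~R, h.2%:~R) <= f h.
Proof. by have := stable_fracv h 0; rewrite /fracv !divr1. Qed.

Lemma stable_lipschitz u v : stable v <= stable u + L * dist1 v u.
Proof.
rewrite -lerBlDr; apply: le_stable => h n; rewrite lerBlDr.
apply: le_trans (stable_le v h n) _; rewrite /approx -addrA lerD2l -mulrDr.
by rewrite ler_wpM2l // addrC dist1_triangle.
Qed.

Lemma fMn h n : f (h *+ n) <= n%:R * f h.
Proof.
elim: n => [|n IH]; first by rewrite mulr0n f0 mul0r.
by rewrite mulrS -nat1r mulrDl mul1r (le_trans (fD _ _)) // lerD2l.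
Qed.

Lemma intrMn (z : int) n : (z *+ n)%:~R = z%:~R * n%:R :> R.
Proof. by rewrite rmorphMn mulr_natr. Qed.

Lemma mulrn_pair (h : int * int) n : h *+ n = (h.1 *+ n, h.2 *+ n).
Proof. by elim: n => [|n IH]; rewrite ?mulr0n // !mulrS IH. Qed.

Lemma stableD u v : stable (u.1 + v.1, u.2 + v.2) <= stable u + stable v.
Proof.
rewrite -lerBlDr; apply: le_stable => h n; rewrite lerBlDr -lerBlDl.
apply: le_stable => k m; rewrite lerBlDl.
(* [N.+1] is the common denominator (n + 1)(m + 1). *)
pose N := (n.+1 * m.+1).-1.
have N1 : N.+1%:R = n.+1%:R * m.+1%:R :> R by rewrite prednK ?muln_gt0 // natrM.
have n0 : n.+1%:R != 0 :> R by rewrite pnatr_eq0.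
have m0 : m.+1%:R != 0 :> R by rewrite pnatr_eq0.
apply: le_trans (stable_le _ (h *+ m.+1 + k *+ n.+1) N) _; rewrite /approx N1.
have -> : fracv (h *+ m.+1 + k *+ n.+1) N =
    ((fracv h n).1 + (fracv k m).1, (fracv h n).2 + (fracv k m).2).
  rewrite /fracv N1 !mulrn_pair /= !intrD !intrMn.
  by congr (_, _); move: n.+1%:R m.+1%:R n0 m0 => x y x0 y0; field; rewrite x0 y0.
rewrite addrACA lerD //.
  rewrite ler_pdivrMr ?mulr_gt0 //.
  apply: le_trans (fD _ _) _; apply: le_trans (lerD (fMn _ _) (fMn _ _)) _.
  move: n.+1%:R m.+1%:R n0 m0 => x y x0 y0.
  by rewrite le_eqVlt; apply/orP; left; apply/eqP; field; rewrite x0 y0.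
rewrite -mulrDr ler_wpM2l // /dist1 /=.
rewrite [leRHS]addrACA lerD //; apply: le_trans (ler_normD _ _);
  by rewrite le_eqVlt; apply/orP; left; apply/eqP; congr (`|_|); ring.
Qed.

Lemma le_of_le_invn (x y C : R) : (forall k : nat, x <= y + C / k.+1%:R) -> x <= y.
Proof.
move=> H; rewrite leNgt; apply/negP => yx.
have [k hk] : exists k : nat, `|C| < (x - y) * k.+1%:R.
  exists (Num.bound (`|C| / (x - y))); rewrite -ltr_pdivrMl ?subr_gt0 // mulrC.
  apply: lt_trans (archi_boundP _) _; first by rewrite divr_ge0 // subr_ge0 ltW.
  by rewrite ltr_nat.
have := H k; rewrite -lerBlDl ler_pdivlMr // => /(lt_le_trans hk).
by rewrite ltNge ler_norm.
Qed.

Lemma stable_scale_int (t : R) h : 0 <= t ->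
  stable (t * h.1%:~R, t * h.2%:~R) <= t * f h.
Proof.
move=> t0; apply: (@le_of_le_invn _ _ (L * (`|h.1%:~R| + `|h.2%:~R|))) => k.
(* The real factor t is approximated from below by m / (k + 1), and the Lipschitz bound turns this
   into an error of order 1 / (k + 1). *)
pose m := Num.truncn (t * k.+1%:R).
have k0 : 0 < k.+1%:R :> R by rewrite ltr0n.
have /andP[hm1 hm2] := truncn_itv (mulr_ge0 t0 (ltW k0)).
rewrite -/m in hm1 hm2.
apply: le_trans (stable_lipschitz (fracv (h *+ m) k) _) _.
have hm1' : m%:R / k.+1%:R <= t by rewrite ler_pdivrMr.
have hm2' : t - m%:R / k.+1%:R <= k.+1%:R^-1.
  by rewrite lerBlDr -[X in X + _]mul1r -mulrDl ler_pdivlMr // nat1r ltW.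
apply: lerD.
  apply: le_trans (stable_fracv _ _) _.
  rewrite ler_pdivrMr // (le_trans (fMn _ _)) // mulrAC ler_wpM2r //.
rewrite -mulrA ler_wpM2l // /dist1 /fracv mulrn_pair /= !intrMn.
have E (z : R) : t * z - z * m%:R / k.+1%:R = (t - m%:R / k.+1%:R) * z.
  by ring.
rewrite !E !normrM -mulrDr mulrC ler_wpM2l ?addr_ge0 //.
by rewrite ger0_norm ?subr_ge0.
Qed.

Lemma stable_scale (t : R) v : 0 <= t -> stable (t * v.1, t * v.2) <= t * stable v.
Proof.
rewrite le_eqVlt => /predU1P[<-|t0].
  by rewrite !mul0r (le_trans (stable_int 0)) // f0.
rewrite -ler_pdivrMl //; apply: le_stable => h n; rewrite ler_pdivrMl //.
apply: le_trans (stable_lipschitz (t * (fracv h n).1, t * (fracv h n).2) _) _.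
rewrite /approx [t * (_ + _)]mulrDr lerD //.
  have n0 : 0 < n.+1%:R :> R by rewrite ltr0n.
  have := @stable_scale_int (t / n.+1%:R) h (divr_ge0 (ltW t0) (ltW n0)).
  by rewrite /fracv /= !mulrA ![t / _ * _]mulrAC.
rewrite [leRHS]mulrCA ler_wpM2l // /dist1 /= -!mulrBr !normrM -mulrDr.
by rewrite ger0_norm // ltW.
Qed.

(** Tested on the four vectors (1,0), (-1,0), (0,1), (0,-1), a linear form below [f] has
    coefficients at most [L] in absolute value. It is therefore an L-Lipschitz minorant, below the
    largest one. *)
Lemma stable_ge (x y : R) : (forall h, x * h.1%:~R + y * h.2%:~R <= f h) ->
  forall v, x * v.1 + y * v.2 <= stable v.
Proof.
move=> hxy v; apply: le_stable => h n.
have n0 : 0 < n.+1%:R :> R by rewrite ltr0n.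
have bound (z : R) : z <= L -> - z <= L -> forall u, z * u <= L * `|u|.
  move=> z1 z2 u; apply: le_trans (ler_norm _) _.
  by rewrite normrM ler_wpM2r // ler_norml lerNl z2.
have f1 h' : x * h'.1%:~R + y * h'.2%:~R <= L * (`|h'.1%:~R| + `|h'.2%:~R|).
  exact: le_trans (hxy _) (f_le _).
have /= := f1 (1, 0); have /= := f1 (-1, 0); have /= := f1 (0, 1); have /= := f1 (0, -1).
rewrite !normrN !normr1 !normr0 !mulrN !mulr1 !mulr0 !addr0 !add0r mulr1 => y2 y1 x2 x1.
have -> : x * v.1 + y * v.2 = (x * h.1%:~R + y * h.2%:~R) / n.+1%:R
    + (x * (v.1 - (fracv h n).1) + y * (v.2 - (fracv h n).2)).
  by rewrite /fracv /=; field; rewrite lt0r_neq0.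
rewrite /approx; apply: lerD; first by rewrite ler_pM2r ?invr_gt0.
by rewrite /dist1 [L * (_ + _)]mulrDr; apply: lerD; apply: bound.
Qed.

End StableNorm.

(** * Limits along rational vectors *)

Section RationalLimit.
Variables (R : realType) (f : int * int -> R) (L : R).
Hypotheses (f_ge0 : forall h, 0 <= f h) (f0 : f 0 = 0)
  (fD : forall h k, f (h + k) <= f h + f k)
  (L_ge0 : 0 <= L) (f_le : forall h, f h <= L * (`|h.1%:~R| + `|h.2%:~R|)).

Lemma fraction_isolated (x : R) (K : nat) : (0 < K)%N ->
  exists2 d : R, 0 < d & forall z : int, `|z%:~R / K%:R - x| < d -> z%:~R / K%:R = x.
Proof.
move=> K0; have K0' : 0 < K%:R :> R by rewrite ltr0n.
have /andP[m1 m2] := floor_itv (x * K%:R).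
set m := Num.floor _ in m1 m2.
have scale z : `|z%:~R / K%:R - x| = `|z%:~R - x * K%:R| / K%:R.
  by rewrite -[X in _ = _ / X](gtr0_norm K0') -normfV -normrM mulrBl mulfK ?lt0r_neq0.
have [e|ne] := eqVneq m%:~R (x * K%:R).
  exists (K%:R^-1); first by rewrite invr_gt0.
  move=> z; rewrite scale -e -intrB -intr_norm ltr_pdivrMr // mulVf ?lt0r_neq0 //.
  rewrite (ltr_int _ _ 1) => hz; have -> : z = m by lia.
  by rewrite e mulfK ?lt0r_neq0.
have m3 : m%:~R < x * K%:R by rewrite lt_neqAle ne.
exists (Num.min (x * K%:R - m%:~R) ((m + 1)%:~R - x * K%:R) / K%:R).
  by rewrite divr_gt0 // lt_min !subr_gt0 m3.
move=> z; rewrite scale ltr_pM2r ?invr_gt0 // lt_min !ltr_norml.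
case/andP => /andP[h1 _] /andP[_ h2]; exfalso.
have : m%:~R < (z%:~R : R) by lra.
have : (z%:~R : R) < (m + 1)%:~R by lra.
by rewrite !ltr_int; lia.
Qed.

(** Fractions with denominator at most M are multiples of 1 / M!, a discrete set, so near v only v
    itself can have two such coordinates. Hence the punctured neighbourhoods in [ell] force the
    product of the denominators to infinity. *)
Lemma denominators_large (v : R * R) (M : nat) : exists2 d : R, 0 < d &
  forall w : rat * rat, ratv R w <> v -> `|(ratv R w).1 - v.1| < d ->
    `|(ratv R w).2 - v.2| < d -> (M <= `|denq w.1| * `|denq w.2|)%N.
Proof.
have [d1 d1_gt0 h1] := fraction_isolated v.1 (fact_gt0 M).
have [d2 d2_gt0 h2] := fraction_isolated v.2 (fact_gt0 M).
exists (Num.min d1 d2) => [|w]; first by rewrite lt_min d1_gt0.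
move=> wv; rewrite !lt_min => /andP[w1 _] /andP[_ w2].
rewrite leqNgt; apply/negP => small; apply: wv.
have frac (q : rat) : (`|denq q| <= M)%N -> exists z : int, ratr q = z%:~R / M`!%:R :> R.
  move=> qM; have q0 : (0 < `|denq q|)%N by rewrite absz_gt0 denq_neq0.
  have /dvdnP[c hc] : (`|denq q| %| M`!)%N by rewrite dvdn_fact // q0.
  exists (numq q * c%:Z); rewrite /ratr hc natrM intrM.
  have -> : (denq q)%:~R = `|denq q|%N%:R :> R by rewrite -[in LHS]absz_denq.
  have c0 : c%:R != 0 :> R.
    rewrite pnatr_eq0; apply/eqP => c0; have := fact_gt0 M.
    by rewrite hc c0.
  by rewrite invfM mulrA -pmulrn mulfK.
have p1 : (0 < `|denq w.1|)%N by rewrite absz_gt0 denq_neq0.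
have p2 : (0 < `|denq w.2|)%N by rewrite absz_gt0 denq_neq0.
have [|z1 e1] := frac w.1; first by nia.
have [|z2 e2] := frac w.2; first by nia.
move: w1 w2; rewrite /ratv /= e1 e2 => /h1 -> /h2 ->.
by case: v {h1 h2}.
Qed.

(** [ellQ] with a general [f] in place of [ellZ]. *)
Definition rat_ext (w : rat * rat) : R :=
  f (numq w.1 * denq w.2, numq w.2 * denq w.1) / (denq w.1 * denq w.2)%:~R.

Lemma rat_extE w (H := (numq w.1 * denq w.2, numq w.2 * denq w.1))
    (D := (`|denq w.1| * `|denq w.2|)%N) :
  [/\ (0 < D)%N, rat_ext w = f H / D%:R & ratv R w = (H.1%:~R / D%:R, H.2%:~R / D%:R)].
Proof.
have p1 : (0 < `|denq w.1|)%N by rewrite absz_gt0 denq_neq0.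
have p2 : (0 < `|denq w.2|)%N by rewrite absz_gt0 denq_neq0.
have d1 : (denq w.1)%:~R = `|denq w.1|%N%:R :> R by rewrite -[in LHS]absz_denq.
have d2 : (denq w.2)%:~R = `|denq w.2|%N%:R :> R by rewrite -[in LHS]absz_denq.
split; first by rewrite muln_gt0 p1.
  by rewrite /rat_ext intrM d1 d2 -natrM.
rewrite /ratv /ratr /H /D /= !intrM natrM d1 d2.
have n1 : `|denq w.1|%N%:R != 0 :> R by rewrite pnatr_eq0 -lt0n.
have n2 : `|denq w.2|%N%:R != 0 :> R by rewrite pnatr_eq0 -lt0n.
by congr (_, _); field; rewrite n1 n2.
Qed.

Lemma rat_ext_ge w : stable f L (ratv R w) <= rat_ext w.
Proof.
have [D0 -> ->] := rat_extE w; move: D0; set D := (_ * _)%N => D0.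
rewrite -(prednK D0); exact: (stable_fracv f_ge0 L_ge0 (_, _)).
Qed.

(** Dividing the common denominator D by n + 1 with quotient q, the numerator H of w is compared
    with q h: subadditivity gives f H <= q f h + L |H - q h| in the 1-norm. The remainder of the
    division accounts for the last term. *)
Lemma rat_ext_le v h n w :
  rat_ext w <= approx f L v h n + L * dist1 (ratv R w) v
    + L * (`|h.1%:~R| + `|h.2%:~R|) / (`|denq w.1| * `|denq w.2|)%N%:R.
Proof.
have [D0 -> hw] := rat_extE w; move: D0 hw.
set D := (_ * _)%N; set H : int * int := (numq w.1 * denq w.2, _) => D0 hw.
have D0' : 0 < D%:R :> R by rewrite ltr0n.
have n0 : 0 < n.+1%:R :> R by rewrite ltr0n.
pose q := (D %/ n.+1)%N; pose r := (D %% n.+1)%N.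
have Dqr : D%:R = q%:R * n.+1%:R + r%:R :> R by rewrite -natrM -natrD -divn_eq.
have rn : r%:R <= n.+1%:R :> R by rewrite ler_nat ltnW // ltn_mod.
have fH : f H <= q%:R * f h + L * (`|H.1%:~R - h.1%:~R * q%:R| + `|H.2%:~R - h.2%:~R * q%:R|).
  rewrite -{1}[H](subrK (h *+ q)) addrC.
  apply: le_trans (fD _ _) _; apply: lerD; first exact: fMn.
  apply: le_trans (f_le _) _; rewrite mulrn_pair /= !intrB !intrMn.
  exact: lexx.
have qn : q%:R / D%:R <= n.+1%:R^-1 :> R.
  rewrite ler_pdivrMr // mulrC ler_pdivlMr // Dqr lerDl //.
have gap (z x : R) (y : int) : z = x * D%:R ->
    `|z - y%:~R * q%:R| / D%:R <= `|x - y%:~R / n.+1%:R| + `|y%:~R| / D%:R.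
  move=> ->; rewrite -[X in _ / X](gtr0_norm D0') -normfV -normrM.
  have -> : (x * D%:R - y%:~R * q%:R) / D%:R =
      (x - y%:~R / n.+1%:R) + y%:~R * (r%:R / (n.+1%:R * D%:R)).
    have -> : r%:R = D%:R - q%:R * n.+1%:R :> R by rewrite Dqr addrC addKr.
    by field; rewrite !lt0r_neq0.
  have r0 : 0 <= r%:R / (n.+1%:R * D%:R) :> R by rewrite divr_ge0 ?mulr_ge0.
  apply: le_trans (ler_normD _ _) _; rewrite lerD2l normrM ler_wpM2l //.
  rewrite ger0_norm // ler_pdivrMr ?mulr_gt0 //.
  by rewrite mulrCA mulVf ?lt0r_neq0 // mulr1.
have wH1 : H.1%:~R = (ratv R w).1 * D%:R by rewrite hw divfK ?lt0r_neq0.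
have wH2 : H.2%:~R = (ratv R w).2 * D%:R by rewrite hw divfK ?lt0r_neq0.
have := gap _ _ h.1 wH1; have := gap _ _ h.2 wH2.
have : q%:R * f h / D%:R <= f h / n.+1%:R.
  by rewrite mulrAC mulrC ler_wpM2l.
have tri := dist1_triangle (ratv R w) v (fracv R h n).
have E (s t x y : R) : (s + t * (x + y)) / D%:R = s / D%:R + t * (x / D%:R + y / D%:R).
  by rewrite mulrDl -mulrA mulrDl.
move=> g0 g2 g1.
have : f H / D%:R <= (q%:R * f h +
    L * (`|H.1%:~R - h.1%:~R * q%:R| + `|H.2%:~R - h.2%:~R * q%:R|)) / D%:R.
  by rewrite ler_pM2r ?invr_gt0.
rewrite E => /le_trans-> //; rewrite /approx -addrA -addrA lerD // -mulrA -!mulrDr.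
rewrite ler_wpM2l //; move: tri g1 g2; rewrite {1}/dist1 /fracv /=.
move: (dist1 _ _) (dist1 _ _) => x y.
rewrite [(_ + _) / D%:R]mulrDl; lra.
Qed.

Lemma dnbhs_boxP (v : R * R) (U : set (R * R)) : dnbhs v U <->
  exists2 d : R, 0 < d &
    forall u, u <> v -> `|u.1 - v.1| < d -> `|u.2 - v.2| < d -> U u.
Proof.
rewrite /dnbhs /within /=; split.
  move=> /nbhs_ballP[d /= d0 hd]; exists d => // u uv u1 u2.
  apply: hd; last by apply/eqP.
  by split; rewrite -ball_normE /ball_ /= distrC.
move=> [d d0 hd]; apply/nbhs_ballP; exists d => //= u [].
rewrite -!ball_normE /ball_ /= => u1 u2 /eqP uv.
by apply: hd; rewrite // distrC.
Qed.

Lemma rational_filter_proper (v : R * R) :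
  ProperFilter (filter_from (dnbhs v) (fun U => @ratv R @^-1` U)%classic).
Proof.
apply: filter_from_proper.
  apply: filter_from_filter; first by exists setT; apply: filterT.
  by move=> U V dU dV; exists (U `&` V)%classic; [apply: filterI|].
move=> U /dnbhs_boxP[d d0 hd].
(* Approximating strictly from above keeps the rational point different from v. *)
have dense (x : R) : exists2 q : rat, x < ratr q & ratr q < x + d.
  have /rat_in_itvoo[q] : x < x + d by rewrite ltrDl.
  by rewrite in_itv /= => /andP[? ?]; exists q.
have [q1 a1 b1] := dense v.1; have [q2 a2 b2] := dense v.2.
exists (q1, q2); apply: hd; rewrite /ratv /=.
- by move=> e; move: a1; rewrite -e ltxx.
- by rewrite ltr_norml; lra.
- by rewrite ltr_norml; lra.
Qed.

Lemma rat_ext_cvg (v : R * R) :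
  (rat_ext @ filter_from (dnbhs v) (fun U => @ratv R @^-1` U) --> stable f L v)%classic.
Proof.
have := rational_filter_proper v; set F := filter_from _ _ => PF.
apply/cvgrPdist_lt => e e0.
(* The tolerance e is split into e/2 for the infimum, e/4 for the distance to v and e/4 for the
   denominators. The lower estimate comes from [rat_ext_ge] and the Lipschitz bound. *)
have [h [n hn]] : exists h n, approx f L v h n < stable f L v + e / 2.
  have [||_ [[h n] _ <-] hn] := @inf_adherent R
      [set approx f L v x.1 x.2 | x in [set: (int * int) * nat]]%classic (e / 2).
  - by rewrite divr_gt0.
  - split; first by exists (approx f L v 0 0), (0, 0%N).
    by exists 0 => _ [x _ <-]; rewrite addr_ge0 ?divr_ge0 ?mulr_ge0 ?dist1_ge0.
  - by exists h, n.
pose C := L * (`|h.1%:~R| + `|h.2%:~R|).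
have C0 : 0 <= C by rewrite mulr_ge0 ?addr_ge0.
pose M := Num.bound (C * 4 / e).
have hM : C * 4 / e < M%:R by apply: archi_boundP; rewrite divr_ge0 ?mulr_ge0 // ltW.
have [d1 d1_gt0 h1] := denominators_large v M.
pose d2 := e / (8 * (L + 1)).
have L1 : 0 < L + 1 by rewrite ltr_wpDl.
have d2_gt0 : 0 < d2 by rewrite divr_gt0 ?mulr_gt0.
exists [set u : R * R | [/\ u <> v, `|u.1 - v.1| < Num.min d1 d2
    & `|u.2 - v.2| < Num.min d1 d2]]%classic.
  apply/dnbhs_boxP; exists (Num.min d1 d2) => //; by rewrite lt_min d1_gt0.
move=> w /= []; rewrite !lt_min => wv /andP[w1 w1'] /andP[w2 w2'].
have MD := h1 w wv w1 w2.
have lo := rat_ext_ge w; have hi := rat_ext_le v h n w.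
have lip := stable_lipschitz f_ge0 L_ge0 (ratv R w) v.
have lip' := stable_lipschitz f_ge0 L_ge0 v (ratv R w).
have hd : L * dist1 (ratv R w) v < e / 4.
  apply: (@le_lt_trans _ _ (L * (d2 + d2))).
    by rewrite ler_wpM2l // /dist1 lerD // ltW.
  have -> : e / 4 = (L + 1) * (d2 + d2) by rewrite /d2; field; rewrite lt0r_neq0.
  by rewrite ltr_pM2r ?addr_gt0 // ltrDl.
have sym : dist1 v (ratv R w) = dist1 (ratv R w) v.
  by rewrite /dist1 (distrC v.1) (distrC v.2).
have hC : C / (`|denq w.1| * `|denq w.2|)%N%:R <= e / 4.
  have D0 : 0 < (`|denq w.1| * `|denq w.2|)%N%:R :> R.
    by rewrite ltr0n muln_gt0 !absz_gt0 !denq_neq0.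
  rewrite ler_pdivrMr // -ler_pdivrMl ?divr_gt0 // invf_div mulrC mulrA.
  apply/ltW/(lt_le_trans hM); by rewrite ler_nat.
rewrite sym in lip; rewrite -/C in hi; rewrite ltr_norml.
move: (L * dist1 _ _) (C / _%:R) (rat_ext w) lip lip' hd hC hi lo => x y z.
by move: hn; lra.
Qed.

End RationalLimit.

(** * Monotonicity *)

(** Sublinearity bounds the value by (1 - t) N u + t N v, which is below N v because 1 - t > 0. *)
Lemma stable_lt_convex (R : realType) (f : int * int -> R) (L : R)
  (f_ge0 : forall h, 0 <= f h) (f0 : f 0 = 0)
  (fD : forall h k, f (h + k) <= f h + f k) (L_ge0 : 0 <= L)
  (u v : R * R) (t : R) : 0 <= t < 1 -> stable f L u < stable f L v ->
  stable f L ((1 - t) * u.1 + t * v.1, (1 - t) * u.2 + t * v.2) < stable f L v.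
Proof.
move=> /andP[t0 t1] uv.
have s0 : 0 <= 1 - t by lra.
have := stableD f_ge0 f0 fD L_ge0 ((1 - t) * u.1, (1 - t) * u.2) (t * v.1, t * v.2).
move=> /le_lt_trans; apply.
have h1 := stable_scale f_ge0 f0 fD L_ge0 u s0.
have h2 := stable_scale f_ge0 f0 fD L_ge0 v t0.
have : (1 - t) * stable f L u < (1 - t) * stable f L v by rewrite ltr_pM2l //; lra.
move: h1 h2; lra.
Qed.

Theorem theorem1p1 (R : realType) (a b : 'M[int]_2)
    (hfree : free_generators a b)
    (htra : `|\tr a| = 3) (htrb : `|\tr b| = 3)
    (htrab : `|\tr (a^-1 * b)| = 3)
    (p q i : R) (hp : 0 <= p) (hq : 0 <= q) (hi : 0 < i) :
  [/\ norm_s a b (q, p) < norm_s a b (q + i, p),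
      norm_s a b (q, p) < norm_s a b (q, p + i)
    & p < q -> norm_s a b (q, p) < norm_s a b (q + i, p - i)].
Proof.
have [L L_ge0 f_le] := ellZ_norm1_bound R hfree htra htrb htrab.
set f := ellZ R a b in f_le.
have f_ge0 : forall h, 0 <= f h by move=> h; apply: ellZ_ge0.
have f0 : f 0 = 0 by apply: ellZ0.
have fD : forall h k, f (h + k) <= f h + f k by move=> h k; apply: ellZD.
pose N := stable f L.
have normE v : norm_s a b v = N v / 2.
  have PF := rational_filter_proper v.
  rewrite /norm_s /ell; congr (_ / _); apply: cvg_lim; first exact: norm_hausdorff.
  exact: rat_ext_cvg.
have between u v w t : 0 <= t < 1 -> N u < N v ->
    w = ((1 - t) * u.1 + t * v.1, (1 - t) * u.2 + t * v.2) ->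
    norm_s a b w < norm_s a b v.
  move=> ht uv ->; rewrite !normE ltr_pM2r //.
  exact: stable_lt_convex.
have N_le t h : 0 <= t -> N (t * h.1%:~R, t * h.2%:~R) <= t * f h.
  exact: stable_scale_int.
have N_linear c d x y : (forall h, c * h.1%:~R + d * h.2%:~R <= f h) ->
    c * x + d * y <= N (x, y).
  by move=> H; apply: (stable_ge f_le H (x, y)).
have N_ge x y : 2 * (x * alpha R + y * beta R) <= N (x, y) /\
    2 * (y * alpha R + x * beta R) <= N (x, y).
  split.
    have -> : 2 * (x * alpha R + y * beta R) = 2 * alpha R * x + 2 * beta R * y by ring.
    apply: N_linear => h; have [+ _] := ellZ_ge R hfree htra htrb htrab h.
    by apply: le_trans; rewrite /weight_exp; lra.
  have -> : 2 * (y * alpha R + x * beta R) = 2 * beta R * x + 2 * alpha R * y by ring.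
  apply: N_linear => h; have [_] := ellZ_ge R hfree htra htrb htrab h.
  by apply: le_trans; rewrite /weight_exp /=; lra.
have ab0 := alphaDbeta_gt0 R; have ba := beta_lt_alpha R.
have f11 : f (1, 1) <= _ := ellZ_11 R hfree htra htrb htrab.
have f12 : f (-1, 2) <= _ := ellZ_N12 R hfree htra htrb htrab.
have f21 : f (2, -1) <= _ := ellZ_2N1 R hfree htra htrb htrab.
(* Averaging the two lower bounds gives N (x,y) >= (x + y)(alpha + beta). *)
have N_gt x y : 0 < x -> y * (alpha R + beta R) < N (x, y) /\
                         y * (alpha R + beta R) < N (y, x).
  move=> x0; have [h1 h2] := N_ge x y; have [h3 h4] := N_ge y x.
  have := mulr_gt0 x0 ab0; lra.
have p2 : 0 <= p / 2 by lra.
have q2 : 0 <= q / 2 by lra.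
split.
- have qip : 0 < q + i + p / 2 by lra.
  (* The horizontal line through (q,p) contains (-p/2, p), a multiple of (-1,2), where N is at most
     p (alpha + beta) and so below N (q+i,p). The point (q,p) lies between these two. *)
  apply: (@between (p / 2 * (-1)%:~R, p / 2 * 2%:~R) _ _ ((q + p / 2) / (q + i + p / 2))).
  + by rewrite ltr_pdivrMr // divr_ge0 //=; lra.
  + apply: le_lt_trans (N_le _ (-1, 2) p2) _.
    have [|+ _] := N_gt (q + i) p; first by lra.
    apply: le_lt_trans; have := ler_wpM2l p2 f12; lra.
  + by rewrite /=; congr (_, _); field; apply: lt0r_neq0; lra.
- have pip : 0 < p + i + q / 2 by lra.
  (* On the vertical line the comparison point is (q, -q/2), a multiple of (2,-1). *)
  apply: (@between (q / 2 * 2%:~R, q / 2 * (-1)%:~R) _ _ ((p + q / 2) / (p + i + q / 2))).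
  + by rewrite ltr_pdivrMr // divr_ge0 //=; lra.
  + apply: le_lt_trans (N_le _ (2, -1) q2) _.
    have [|_] := N_gt (p + i) q; first by lra.
    apply: le_lt_trans; have := ler_wpM2l q2 f21; lra.
  + by rewrite /=; congr (_, _); field; apply: lt0r_neq0; lra.
- move=> pq; have d0 : 0 < q - p + 2 * i by lra.
  have m0 : 0 <= (p + q) / 2 by lra.
  (* On the line of direction (1,-1) the comparison point is on the diagonal, where N is at most (p
     + q)(alpha + beta). *)
  apply: (@between ((p + q) / 2 * 1%:~R, (p + q) / 2 * 1%:~R) _ _
    ((q - p) / (q - p + 2 * i))).
  + by rewrite ltr_pdivrMr // divr_ge0 //=; lra.
  + apply: le_lt_trans (N_le _ (1, 1) m0) _.
    have [+ _] := N_ge (q + i) (p - i).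
    apply: lt_le_trans; have := ler_wpM2l m0 f11.
    (* The excess over (p + q)(alpha + beta) of the lower bound at (q+i,p-i). It is positive because
       alpha > beta, that is, e > 1. *)
    have : 0 < (q - p + 2 * i) * (alpha R - beta R) by rewrite mulr_gt0 ?subr_gt0.
    lra.
  + by rewrite /=; congr (_, _); field; apply: lt0r_neq0; lra.
Qed.
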